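(* Let $(X,T)$ be a minimal Cantor system given by a proper and clean Bratteli-Vershik representation of Toeplitz type, of rank $d$ and with characteristic sequence $(q_n; n\ge 1)$, and let $\mu$ be an ergodic $T$-invariant probability measure on $X$. Let $a,b$ be integers with $b\ge 1$ and $\gcd(a,b)=1$, and put $\lambda=\exp(2i\pi a/b)$. Then $\lambda$ is a non continuous eigenvalue of $(X,T)$ for $\mu$ if and only if both of the following hold: (1) there is an integer $\mathbf b$ with $1<\mathbf b\le d$ such that $b/\gcd(b,p_n)=\mathbf b$ for all $n$ large enough; (2) for all $t_2\in I_\mu$, $$\sum_{t_1\in V_m}\frac{\left|\sum_{s\in \overline S_{m,n}(t_1,t_2)}\lambda^{-p_m s}\right|}{q_{m,n}}\longrightarrow 1$$ as $m,n\to\infty$, uniformly in $m,n\in\mathbb N$ with $m<n$ (i.e. for every $\varepsilon>0$ there is $N$ such that the left-hand side is within $\varepsilon$ of $1$ for all $n>m>N$).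
   Context: Bratteli diagrams. A Bratteli diagram is an infinite graph $(V,E)$ with $V=V_0\cup V_1\cup\cdots$, $E=E_1\cup E_2\cup\cdots$ (disjoint finite levels), $V_0=\{v_0\}$, edges of $E_n$ going from $V_{n-1}$ to $V_n$, every vertex of $V_n$ being the end-point of some edge of $E_n$ ($n\ge1$) and the initial point of some edge of $E_{n+1}$ ($n\ge 0$). $M_n$ is the $V_{n-1}\times V_n$ matrix whose $(t_1,t_2)$ entry is the number of edges of $E_n$ from $t_1$ to $t_2$. $E_{m,n}$ is the set of paths from $V_m$ to $V_n$. $h_n(t)$ is the number of paths from $v_0$ to $t\in V_n$. An ordered diagram carries a partial order $\preceq$ on $E$ in which two edges are comparable iff they have the same end-point; it induces an order on $E_{m,n}$: $(e_{m+1},\dots,e_n)\preceq(f_{m+1},\dots,f_n)$ iff for some $i$, $e_j=f_j$ for $i<j\le n$ and $e_i\preceq f_i$. $X$ is the space of infinite paths $x=(x_1,x_2,\dots)$ from $v_0$ (with the topology generated by cylinders, assumed a Cantor set). The diagram is properly ordered if there is a unique infinite path $x_{\max}$ all of whose edges are maximal and a unique one $x_{\min}$ all of whose edges are minimal; then the Vershik map $T$ sends $x\ne x_{\max}$ to $(y_1,\dots,y_{n-1},y_n,x_{n+1},\dots)$, where $n$ is least with $x_n$ not maximal, $y_n$ is the successor of $x_n$, and $(y_1,\dots,y_{n-1})$ is the minimal path from $v_0$ to the initial vertex of $y_n$; and $T x_{\max}=x_{\min}$. A (Bratteli-Vershik) representation of a system is such a diagram whose Vershik system is conjugate to it; the system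 is identified with the Vershik system $(X,T)$. Proper, of rank $d$: the diagram is properly ordered and (H1) $h_1(t)=1$ for all $t\in V_1$; (H2) $M_n>0$ entrywise for $n\ge2$; (H3) $\#V_n=d$ for all $n\geq 1$, and $V_n$ is identified with $\{1,\dots,d\}$; (H4) for every $n\ge2$ all maximal edges of $E_n$ start at the same vertex of $V_{n-1}$. Toeplitz type: for each $n\ge1$ the number $q_n$ of edges of $E_n$ ending at a vertex of $V_n$ does not depend on the vertex. $(q_n;n\ge1)$ is the characteristic sequence, $p_n=q_1\cdots q_n$, $q_{m,n}=q_{m+1}\cdots q_n$ for $0\le m<n$. $\tau_n(x)\in V_n$ is the vertex of level $n$ through which the path $x$ passes. Clean: there is $\delta>0$ such that for each ergodic invariant probability measure $\mu$ there is a set $I_\mu\subseteq\{1,\dots,d\}$ with $\mu(\tau_n=t)\ge\delta$ for all $t\in I_\mu$, $n\ge1$, and $\lim_{n\to\infty}\mu(\tau_n=t)=0$ for $t\notin I_\mu$; and $I_\mu\cap I_\nu=\emptyset$ for distinct ergodic $\mu,\nu$. Suffixes: for $x\in X$ and $m<n$, $\overline s_{m,n}(x)$ is the number of paths in $E_{m,n}$ ending at $\tau_n(x)$ that are strictly bigger than $(x_{m+1},\dots,x_n)$. For $t_1\in V_m,t_2\in V_n$, $\overline S_{m,n}(t_1,t_2)=\{\overline s_{m,n}(x): \tau_m(x)=t_1,\ \tau_n(x)=t_2\}$. Eigenvalues: $\lambda\in\mathbb C$ is an eigenvalue of $(X,T)$ for $\mu$ if there is $f\in L^2(X,\mu)$,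 $f\ne0$, with $f\circ T=\lambda f$; it is a continuous eigenvalue if there is a continuous $f:X\to\mathbb C$, $f\neq0$, with $f\circ T=\lambda f$. A non continuous eigenvalue for $\mu$ is an eigenvalue for $\mu$ that is not a continuous eigenvalue. *)

(* Defs.v *)
From HB Require Import structures.
From mathcomp Require Import all_boot all_order all_algebra.
From mathcomp Require Import all_classical all_reals all_analysis.
From mathcomp Require Import complex.

Set Implicit Arguments.
Unset Strict Implicit.
Unset Printing Implicit Defensive.

Import Order.TTheory GRing.Theory Num.Theory.
Import numFieldNormedType.Exports.
Import ComplexField.Normc.

Local Open Scope classical_set_scope.
Local Open Scope ring_scope.

Fact edge_display : Order.disp_t. Proof. exact: Order.Disp tt tt. Qed.

(* Ordered Bratteli diagrams. Edge levels are shifted by one: [edge B n] is the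
   set E_{n+1} of edges from V_n to V_{n+1}. *)
Record bratteli := Bratteli {
  vertex : nat -> finType;
  edge : nat -> finPOrderType edge_display;
  src : forall n, edge n -> vertex n;
  tgt : forall n, edge n -> vertex n.+1;
  card_vertex0 : #|vertex 0| = 1%N;
  tgt_surj : forall n (v : vertex n.+1), exists e : edge n, tgt e = v;
  src_surj : forall n (v : vertex n), exists e : edge n, src e = v;
  edge_comparable :
    forall n (e f : edge n), (e >=< f)%O = (tgt e == tgt f) }.

Arguments src {b n} e.
Arguments tgt {b n} e.

Definition max_edge (B : bratteli) n (e : edge B n) : bool :=
  [forall f : edge B n, ~~ (e < f)%O].

Definition min_edge (B : bratteli) n (e : edge B n) : bool :=
  [forall f : edge B n, ~~ (f < e)%O].

Definition succ_edge (B : bratteli) n (e f : edge B n) : bool :=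
  (e < f)%O && [forall g : edge B n, ~~ ((e < g)%O && (g < f)%O)].

(* The (t1, t2) entry of M_{n+1}. *)
Definition adjacency (B : bratteli) n (t1 : vertex B n) (t2 : vertex B n.+1) :
    nat :=
  #|[set e : edge B n | (src e == t1) && (tgt e == t2)]%SET|.

(* A family (e_{m+1}, ..., e_n) of edges; it is a path of E_{m,n} when
   [is_path] holds. Vertices are compared in the total space {n & V_n}, because
   [vertex B (m + j).+1] and [vertex B (m + j')] are not convertible for
   j' = j + 1. *)
Definition edges_between (B : bratteli) (m n : nat) :=
  {dffun forall j : 'I_(n - m), edge B (m + j)}.

Definition is_path (B : bratteli) m n (p : edges_between B m n) : bool :=
  [forall j, forall j', (val j' == (val j).+1) ==>
    (Tagged (vertex B) (tgt (p j)) == Tagged (vertex B) (src (p j')))].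

Definition ends_at (B : bratteli) m n (p : edges_between B m n)
    (v : vertex B n) : bool :=
  [forall j, ((m + val j).+1 == n)%N ==>
    (Tagged (vertex B) (tgt (p j)) == Tagged (vertex B) v)].

(* The strict part of the order induced on E_{m,n}: the comparison at the last
   index where the two paths differ. *)
Definition path_lt (B : bratteli) m n (p p' : edges_between B m n) : bool :=
  [exists i, (p i < p' i)%O &&
    [forall j, (val i < val j)%N ==> (p j == p' j)]].

Definition height (B : bratteli) n (t : vertex B n) : nat :=
  #|[set p : edges_between B 0 n | is_path p && ends_at p t]%SET|.

Definition is_min_path_to (B : bratteli) n (p : edges_between B 0 n)
    (v : vertex B n) : Prop :=
  [/\ is_path p, ends_at p v &
      forall p' : edges_between B 0 n,
        is_path p' -> ends_at p' v -> ~~ path_lt p' p].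

Record path_space (B : bratteli) := Path {
  path_edge :> forall n, edge B n;
  path_edgeP : forall n, tgt (path_edge n) = src (path_edge n.+1) }.

Lemma path_space_inhabited (B : bratteli) : exists x : path_space B, True.
Proof.
have [v0 _] : exists v : vertex B 0, true.
  by have /card_gt0P[v _] : (0 < #|vertex B 0|)%N; [rewrite card_vertex0|exists v].
pose out n (v : vertex B n) := projT1 (cid (src_surj v)).
have outP n (v : vertex B n) : src (out n v) = v by rewrite /out; case: cid.
pose vs := fix vs n : vertex B n :=
  if n is n'.+1 then tgt (out n' (vs n')) else v0.
have vsP n : tgt (out n (vs n)) = src (out n.+1 (vs n.+1)) by rewrite outP.
by exists (Path vsP).
Qed.

HB.instance Definition _ (B : bratteli) := gen_eqMixin (path_space B).
HB.instance Definition _ (B : bratteli) := gen_choiceMixin (path_space B).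
HB.instance Definition _ (B : bratteli) :=
  isPointed.Build (path_space B) (projT1 (cid (path_space_inhabited B))).

Definition cylinder (B : bratteli) (c : path_space B * nat) :
    set (path_space B) :=
  [set y | forall i, (i < c.2)%N -> y i = c.1 i].

HB.instance Definition _ (B : bratteli) :=
  isSubBaseTopological.Build (path_space B) setT (@cylinder B).

(* The vertex of level n, given as the source of x_{n+1}. *)
Definition tau (B : bratteli) n (x : path_space B) : vertex B n := src (x n).

Definition segment (B : bratteli) (m n : nat) (x : path_space B) :
    edges_between B m n :=
  [ffun j : 'I_(n - m) => x (m + j)%N].

Definition max_path (B : bratteli) (x : path_space B) : Prop :=
  forall n, max_edge (x n).

Definition min_path (B : bratteli) (x : path_space B) : Prop :=
  forall n, min_edge (x n).

Definition properly_ordered (B : bratteli) : Prop :=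
  (exists! x : path_space B, max_path x) /\
  (exists! x : path_space B, min_path x).

Definition vershik_rel (B : bratteli) (x y : path_space B) : Prop :=
  (max_path x /\ min_path y) \/
  exists n : nat,
    [/\ (forall i, (i < n)%N -> max_edge (x i)) /\ ~~ max_edge (x n),
        succ_edge (x n) (y n),
        is_min_path_to (segment 0 n y) (src (y n)) &
        forall i, (n < i)%N -> y i = x i].

(* When the diagram is properly ordered, [vershik_rel x] holds of exactly one
   path; the default value x plays no role then. *)
Definition vershik (B : bratteli) (x : path_space B) : path_space B :=
  xget x [set y | vershik_rel x y].

Arguments vershik B x : clear implicits.

(* [vtx n] identifies {1, ..., d} with V_n for n >= 1 and carries no
   information for n = 0. *)
Definition proper_of_rank (B : bratteli) (d : nat)
    (vtx : forall n, 'I_d -> vertex B n) : Prop :=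
  properly_ordered B /\
  [/\ forall t : vertex B 1, height t = 1%N,
      forall n (t1 : vertex B n.+1) (t2 : vertex B n.+2),
        (0 < adjacency t1 t2)%N,
      forall n, (0 < n)%N -> bijective (vtx n) &
      forall n (e f : edge B n.+1), max_edge e -> max_edge f -> src e = src f].

(* Only the values q_n with n >= 1 matter. *)
Definition toeplitz_type (B : bratteli) (q : nat -> nat) : Prop :=
  forall n (t : vertex B n.+1), #|[set e : edge B n | tgt e == t]%SET| = q n.+1.

Definition qprod (q : nat -> nat) (m n : nat) : nat :=
  (\prod_(m.+1 <= i < n.+1) q i)%N.

Definition suffix_count (B : bratteli) (m n : nat) (x : path_space B) : nat :=
  #|[set p : edges_between B m n |
      [&& is_path p, ends_at p (tau n x) & path_lt (segment m n x) p]]%SET|.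

Definition suffix_set (B : bratteli) (m n : nat)
    (t1 : vertex B m) (t2 : vertex B n) : set nat :=
  [set s | exists x : path_space B,
    [/\ tau m x = t1, tau n x = t2 & suffix_count m n x = s]].

Definition minimal_cantor_system (X : topologicalType) (T : X -> X) : Prop :=
  [/\ cantor_like X,
      continuous T,
      exists2 S : X -> X, continuous S & cancel T S /\ cancel S T &
      forall A : set X, closed A -> A !=set0 -> T @` A `<=` A -> A = setT].

Definition borel (X : ptopologicalType) := g_sigma_algebraType (@open X).

Section dynamics.
Context (R : realType) (X : ptopologicalType) (T : X -> X).
Implicit Types (mu nu : probability (borel X) R) (lambda : R[i]).

Definition ergodic mu : Prop :=
  (forall A : set (borel X), measurable A -> mu (T @^-1` A) = mu A) /\
  (forall A : set (borel X), measurable A -> T @^-1` A = A ->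
     mu A = 0%E \/ mu A = 1%E).

Definition complexL2 mu (f : X -> R[i]) : Prop :=
  [/\ measurable_fun [set: borel X] (fun x : borel X => complex.Re (f x)),
      measurable_fun [set: borel X] (fun x : borel X => complex.Im (f x)) &
      (\int[mu]_(x in [set: borel X]) ((normc (f x)) ^+ 2)%:E < +oo)%E].

Definition eigenvalue_for mu lambda : Prop :=
  exists f : X -> R[i],
    [/\ complexL2 mu f,
        ~ {ae mu, forall x : borel X, f x = 0} &
        {ae mu, forall x : borel X, f (T x) = lambda * f x}].

Definition continuous_eigenvalue lambda : Prop :=
  exists f : X -> R[i],
    [/\ continuous (f : X -> R[i]^o),
        exists x, f x <> 0 &
        forall x, f (T x) = lambda * f x].

Definition noncontinuous_eigenvalue_for mu lambda : Prop :=
  eigenvalue_for mu lambda /\ ~ continuous_eigenvalue lambda.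

End dynamics.

(* Two measures are distinct when they differ on some measurable set: Leibniz
   equality would also compare their irrelevant values on the other sets. *)
Definition clean (R : realType) (B : bratteli) (d : nat)
    (vtx : forall n, 'I_d -> vertex B n)
    (I : probability (borel (path_space B)) R -> {set 'I_d}) : Prop :=
  (exists2 delta : R, 0 < delta &
    forall mu, ergodic (vershik B) mu ->
      (forall t, t \in I mu -> forall n, (0 < n)%N ->
         (delta%:E <= mu [set x | tau n x = vtx n t])%E) /\
      (forall t, t \notin I mu ->
         mu [set x | tau n x = vtx n t] @[n --> \oo] --> 0%E)) /\
  (forall mu nu, ergodic (vershik B) mu -> ergodic (vershik B) nu ->
     (exists2 A, measurable A & mu A <> nu A) ->
     (I mu :&: I nu = finset.set0)%SET).

Definition expi (R : realType) (theta : R) : R[i] :=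
  Complex (cos theta) (sin theta).

(* Main.v *)
Require Import Defs.
From HB Require Import structures.
From mathcomp Require Import all_boot all_order all_algebra.
From mathcomp Require Import all_classical all_reals all_analysis.
From mathcomp Require Import measurable_realfun complex zify ring lra.

Set Implicit Arguments.
Unset Strict Implicit.
Unset Printing Implicit Defensive.

Import Order.TTheory GRing.Theory Num.Theory.
Import numFieldNormedType.Exports.
Import ComplexField.Normc.

Local Open Scope classical_set_scope.
Local Open Scope ring_scope.

(* Write s_n(x) for the suffix count of x between levels 0 and n. By the Toeplitz
   property the towers of level n all have height p_n; s_n takes the values
   0, ..., p_n - 1, the Vershik map T lowers it by one modulo p_n, the pair
   (tau_n x, s_n x) determines the first n edges of x, and
   s_n = s_m + p_m * (suffix count between m and n). If b divides some p_n then
   lambda ^ (- s_n) is a continuous eigenfunction; conversely (H4) makes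
   T ^ (p_n) x_max converge to x_max, so a continuous eigenvalue satisfies
   lambda ^ (p_n) = 1 for large n.

   If lambda is an eigenvalue for mu, a fundamental domain for multiplication by
   lambda turns an eigenfunction into one, F, with values in the b-th roots of
   unity. Approximating its level sets by clopen sets, and sliding along the
   towers, F = lambda ^ (- s_n) c_n(tau_n) outside a set of small measure for all
   large n. Comparing levels m < n gives (2). Since F lambda ^ (s_m) is multiplied
   by lambda ^ (p_m) under T ^ (p_m), and mostly takes the #V_m values of c_m, the
   order of lambda ^ (p_m) is at most d.

   Conversely fix t in I_mu and an ultrafilter on the levels. For r modulo b, the
   ultralimits of mu (A `&` [tau_n = t, s_n = r mod b]) are finitely additive in A
   and dominated by mu, hence measures with densities h_r, and h_r o T = h_(r+1).
   Then sum_r lambda ^ (- r) h_r is an eigenfunction, and (2) keeps its Fourier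
   sums over the bases of the towers of a fixed level m away from 0. *)

(** * Paths and suffix counts *)

Section Rank.
Context (B : bratteli) (q : nat -> nat) (tB : toeplitz_type B q).
Local Open Scope nat_scope.

(** Counting the edges above [e] makes the rank the digit of a suffix count: maximal edges get 0,
    and the order on edges with a common end is reversed. *)
Definition rank n (e : edge B n) : nat := #|[set f : edge B n | (e < f)%O]%SET|.

Lemma lt_tgt n (e f : edge B n) : (e < f)%O -> tgt e = tgt f.
Proof.
by move=> /ltW ef; apply/eqP; rewrite -edge_comparable /Order.comparable ef.
Qed.

Lemma rank_lt_mono n (e f : edge B n) : (e < f)%O -> rank f < rank e.
Proof.
move=> ef; apply: proper_card; apply/fintype.properP; split.
  by apply/fintype.subsetP => g; rewrite !inE; exact: lt_trans.
by exists f; rewrite !inE ?ef// ltxx.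
Qed.

(** Edges with a common end are comparable, so the strict monotonicity of the rank can be
    reversed. *)
Lemma edge_ltE n (e f : edge B n) :
  tgt e = tgt f -> (e < f)%O = (rank f < rank e).
Proof.
move=> /eqP; rewrite -edge_comparable => /comparable_ltgtP [ef|fe|->].
- by rewrite rank_lt_mono.
- by apply/esym/negbTE; rewrite -leqNgt ltnW// rank_lt_mono.
- by rewrite ltnn.
Qed.

Lemma rank_inj n (e f : edge B n) : tgt e = tgt f -> rank e = rank f -> e = f.
Proof.
move=> ef r; have := edge_ltE ef; have := edge_ltE (esym ef).
rewrite r ltnn => /negbT nfe /negbT nef.
move/eqP: ef; rewrite -edge_comparable => /comparable_ltgtP [ef|fe|//].
  by rewrite ef in nef.
by rewrite fe in nfe.
Qed.

Lemma rank_ltq n (e : edge B n) : rank e < q n.+1.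
Proof.
rewrite -(tB (tgt e)); apply: proper_card; apply/fintype.properP; split.
  by apply/fintype.subsetP => g; rewrite !inE => /lt_tgt ->.
by exists e; rewrite !inE ?ltxx.
Qed.

(** The rank is injective on the [q n.+1] edges ending at [v] and stays below [q n.+1], so by
    counting it takes every such value. *)
Lemma rank_onto n (v : vertex B n.+1) k :
  k < q n.+1 -> exists2 e : edge B n, tgt e = v & rank e = k.
Proof.
move=> kq.
pose h (e : edge B n) := Ordinal (rank_ltq e).
have hF : (h @: [set e | tgt e == v] = [set: 'I_(q n.+1)])%SET.
  apply/eqP; rewrite eqEcard finset.subsetT /= card_in_imset ?cardsT ?card_ord ?tB//.
  move=> e f; rewrite !inE => /eqP te /eqP tf /(congr1 val)/= r.
  by apply: rank_inj; rewrite // te tf.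
have : (Ordinal kq \in h @: [set e : edge B n | tgt e == v])%SET by rewrite hF finset.inE.
case/imsetP => e; rewrite inE => /eqP te /(congr1 val)/= ->.
by exists e.
Qed.

Lemma max_edgeE n (e : edge B n) : max_edge e = (rank e == 0).
Proof.
rewrite cards_eq0; apply/forallP/eqP => [mx|re f].
  by apply/finset.setP => f; rewrite !inE (negbTE (mx f)).
by apply/negP => ef; have := finset.in_set0 f; rewrite -re inE ef.
Qed.

Lemma q_gt0 n : 0 < q n.+1.
Proof.
have [v _] : exists v : vertex B n.+1, true.
  have [v0 _] : exists v : vertex B 0, true.
    have /card_gt0P[v _] : (0 < #|vertex B 0|)%N; [by rewrite card_vertex0|by exists v].
  elim: n.+1 => [|k [v _]]; first by exists v0.
  by have [e _] := src_surj v; exists (tgt e).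
by have [e _] := tgt_surj v; exact: leq_ltn_trans (rank_ltq e).
Qed.

Lemma succ_edge_rank n (e f : edge B n) : succ_edge e f -> rank e = (rank f).+1.
Proof.
case/andP => ef /forallP h; apply/eqP; rewrite eqn_leq rank_lt_mono// andbT leqNgt.
apply/negP => lt.
have tef := lt_tgt ef.
(* If the ranks differed by more than one, the edge of rank [(rank f).+1] would lie strictly between
   [e] and [f]. *)
have [g tg rg] := rank_onto (tgt e) (ltn_trans lt (rank_ltq e)).
by have := h g; rewrite !edge_ltE ?tg ?rg ?lt ?leqnn.
Qed.

Lemma succ_edge_exists n (e : edge B n) : ~~ max_edge e -> exists f, succ_edge e f.
Proof.
rewrite max_edgeE -lt0n => r0.
have [f tf rf] := rank_onto (tgt e) (leq_ltn_trans (leq_pred _) (rank_ltq e)).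
exists f; rewrite /succ_edge edge_ltE// rf prednK// leqnn/=.
apply/forallP => g; apply/negP => /andP[eg gf].
have := rank_lt_mono eg; have := rank_lt_mono gf; rewrite rf; lia.
Qed.

End Rank.

(** * Mixed radix expansions *)

Section MixedRadix.
Context (q : nat -> nat) (q_pos : forall n, (0 < q n.+1)%N).
Implicit Types dg : nat -> nat.
Local Open Scope nat_scope.

(** A numeral with its least significant digit at index m. Digit i will be the rank of an edge of
    E_{i+1}, whence the base [q i.+1] at that place. *)
Definition radix_value m n dg : nat := \sum_(m <= i < n) qprod q m i * dg i.

Lemma qprodnn n : qprod q n n = 1.
Proof. by rewrite /qprod big_geq. Qed.

Lemma qprodSr m n : m <= n -> qprod q m n.+1 = qprod q m n * q n.+1.
Proof. by move=> mn; rewrite /qprod big_nat_recr. Qed.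

Lemma qprod_gt0 m n : 0 < qprod q m n.
Proof.
by rewrite /qprod big_add1 /=; apply: prodn_gt0 => i.
Qed.

Lemma qprodM l m n : l <= m -> m <= n ->
  qprod q l m * qprod q m n = qprod q l n.
Proof. by move=> lm mn; rewrite /qprod -big_cat_nat. Qed.

Lemma radix_valueSr m n dg : m <= n ->
  radix_value m n.+1 dg = radix_value m n dg + qprod q m n * dg n.
Proof. by move=> mn; rewrite /radix_value big_nat_recr. Qed.

Lemma radix_value0 m n dg : n <= m -> radix_value m n dg = 0.
Proof. by move=> nm; rewrite /radix_value big_geq. Qed.

Lemma radix_value_cat l m n dg : l <= m -> m <= n ->
  radix_value l n dg = radix_value l m dg + qprod q l m * radix_value m n dg.
Proof.
move=> lm mn; rewrite /radix_value (big_cat_nat lm mn)/=; congr (_ + _).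
rewrite big_distrr/= big_nat_cond [RHS]big_nat_cond; apply: eq_bigr => i /andP[/andP[mi _] _].
by rewrite mulnA qprodM.
Qed.

Lemma radix_value_lt m n dg : (forall i, m <= i < n -> dg i < q i.+1) ->
  radix_value m n dg < qprod q m n.
Proof.
elim: n => [|n IH] dgq; first by rewrite radix_value0// qprod_gt0.
case: (leqP m n) => mn; last by rewrite radix_value0// qprod_gt0.
rewrite radix_valueSr// qprodSr//.
have := IH (fun i h => dgq i (ltac:(lia))); have := dgq n; rewrite mn ltnSn => /(_ isT).
move: (qprod _ _ _) (radix_value _ _ _) (q n.+1) (dg n) => Q v k d; nia.
Qed.

Lemma radix_value_onto m n c : c < qprod q m n ->
  exists2 dg, (forall i, dg i < q i.+1) & radix_value m n dg = c.
Proof.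
elim: n c => [|n IH] c.
  rewrite /qprod big_geq// ltnS leqn0 => /eqP ->.
  by exists (fun=> 0); rewrite // radix_value0.
case: (leqP m n) => mn; last first.
  rewrite /qprod big_geq// ltnS leqn0 => /eqP ->.
  by exists (fun=> 0); rewrite // radix_value0.
rewrite qprodSr// => cQ.
have Q0 := qprod_gt0 m n.
have [dg dgq dgc] := IH (c %% qprod q m n) (ltn_pmod _ Q0).
exists (fun i => if i == n then c %/ qprod q m n else dg i).
  by move=> i; case: eqP => [->|//]; rewrite ltn_divLR// mulnC.
rewrite radix_valueSr// eqxx [RHS](divn_eq c (qprod q m n)) addnC mulnC -dgc; congr (_ + _).
by rewrite /radix_value; apply: eq_big_nat => i /andP[_ ni]; rewrite ltn_eqF.
Qed.

(** The digits below the highest differing one contribute less than one unit of its weight. The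
    order on paths is decided in the same way, at the last edge where they differ. *)
Lemma radix_value_ltP m n dg dg' :
  (forall i, dg i < q i.+1) -> (forall i, dg' i < q i.+1) ->
  radix_value m n dg < radix_value m n dg' <->
  exists i, [/\ m <= i < n, dg i < dg' i &
             forall j, i < j < n -> dg j = dg' j].
Proof.
move=> h h'; elim: n => [|n IH].
  by rewrite !radix_value0//; split => // -[i []]; rewrite ltn0 andbF.
case: (leqP m n) => mn; last first.
  by rewrite !radix_value0//; split => // -[i []]; lia.
rewrite !radix_valueSr//.
have b := @radix_value_lt m n _ (fun i _ => h i).
have b' := @radix_value_lt m n _ (fun i _ => h' i).
case: (ltngtP (dg n) (dg' n)) => c.
- split; last by move=> _; nia.
  by move=> _; exists n; split; [rewrite mn ltnSn|exact: c|move=> j; lia].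
- split; first by nia.
  move=> [i [mi lt eq]]; have [iEn|ni] := eqVneq i n.
    by move: lt; rewrite iEn; lia.
  by have := eq n; lia.
- rewrite c ltn_add2r IH; split.
    move=> [i [mi lt eq]]; exists i; split => //; first lia.
    by move=> j ij; have [->//|nj] := eqVneq j n; apply: eq; lia.
  move=> [i [mi lt eq]]; exists i; split => //.
    have [iEn|ni] := eqVneq i n; last lia.
    by move: lt; rewrite iEn; lia.
  by move=> j ij; apply: eq; lia.
Qed.

Lemma radix_value_inj m n dg dg' :
  (forall i, dg i < q i.+1) -> (forall i, dg' i < q i.+1) ->
  radix_value m n dg = radix_value m n dg' ->
  forall i, m <= i < n -> dg i = dg' i.
Proof.
move=> h h'; elim: n => [|n IH]; first by move=> _ i; rewrite ltn0 andbF.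
case: (leqP m n) => mn; last by move=> _ i; lia.
rewrite !radix_valueSr// => E.
have b := @radix_value_lt m n _ (fun i _ => h i).
have b' := @radix_value_lt m n _ (fun i _ => h' i).
have dn : dg n = dg' n by nia.
move=> i mi; have [->//|ni] := eqVneq i n; apply: IH; last lia.
by move: E; rewrite dn => /addIn.
Qed.

End MixedRadix.

(** * Finite paths and their numerical codes *)

Section Paths.
Context (B : bratteli) (q : nat -> nat) (tB : toeplitz_type B q).
Local Open Scope nat_scope.

Let q_pos := q_gt0 tB.

(* Finite paths are handled as restrictions of families of edges indexed by all
   levels, which avoids transport along equalities between levels. *)
Definition edge_family := forall i, edge B i.

Definition restrict_family m n (e : edge_family) : edges_between B m n :=
  [ffun j : 'I_(n - m) => e (m + j)].

Definition connected_between m n (e : edge_family) :=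
  forall i, m <= i -> i.+1 < n -> tgt (e i) = src (e i.+1).

Definition family_ends_at m n (e : edge_family) (v : vertex B n) :=
  forall i, m <= i -> i.+1 = n -> Tagged (vertex B) (tgt (e i)) = Tagged (vertex B) v.

Definition family_code m n (e : edge_family) : nat :=
  radix_value q m n (fun i => rank (e i)).

Lemma edge_family_exists : exists e : edge_family, True.
Proof.
suff h n : exists e : edge B n, True.
  by exists (fun n => projT1 (cid (h n))).
have [v0 _] : exists v : vertex B 0, true.
  by have /card_gt0P[v _] : 0 < #|vertex B 0|; [rewrite card_vertex0|exists v].
elim: n => [|n [e _]]; first by have [e _] := src_surj v0; exists e.
by have [f _] := src_surj (tgt e); exists f.
Qed.

Lemma is_pathE m n e : is_path (restrict_family m n e) <-> connected_between m n e.
Proof.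
split=> [/forallP h i mi ni|h].
  have i1 : i - m < n - m by lia.
  have i2 : (i - m).+1 < n - m by lia.
  have /forallP/(_ (Ordinal i2)) := h (Ordinal i1).
  rewrite eqxx/= !ffunE/=.
  have -> : m + (i - m).+1 = i.+1 by lia.
  have -> : m + (i - m) = i by lia.
  by move=> /eqP E; exact: eq_from_Tagged E.
apply/forallP => j; apply/forallP => j'; apply/implyP => /eqP jj.
rewrite !ffunE jj addnS -h ?leq_addr//.
have := ltn_ord j'; rewrite jj; lia.
Qed.

Lemma ends_atE m n e (v : vertex B n) :
  ends_at (restrict_family m n e) v <-> family_ends_at m e v.
Proof.
split=> [/forallP h i mi ni|h].
  have i1 : i - m < n - m by lia.
  have := h (Ordinal i1).
  rewrite /= !ffunE/= subnKC// => /implyP h1; apply/eqP; apply: h1; exact/eqP.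
apply/forallP => j; apply/implyP => /eqP jj.
by rewrite !ffunE h ?leq_addr.
Qed.

Lemma path_ltE m n e f :
  path_lt (restrict_family m n e) (restrict_family m n f) <->
  exists i, [/\ m <= i < n, (e i < f i)%O & forall j, i < j < n -> e j = f j].
Proof.
split=> [/existsP[i /andP[]]|[i [mi ef eqf]]].
  rewrite !ffunE => ef /forallP h; exists (m + i); split => //.
    by have := ltn_ord i; lia.
  move=> j ij; have mj : m <= j by move/andP: ij => [/ltnW/(leq_trans (leq_addr _ _))].
  have jm : j - m < n - m by lia.
  have := h (Ordinal jm); rewrite /= !ffunE/= subnKC//.
  by rewrite ltn_subRL; case/andP: ij => -> _ /eqP.
have i1 : i - m < n - m by lia.
apply/existsP; exists (Ordinal i1); rewrite !ffunE/= subnKC ?ef/=; last lia.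
apply/forallP => j; apply/implyP => ij; rewrite !ffunE eqf//.
have := ltn_ord j; lia.
Qed.

Lemma restrict_family_eq m n e f :
  restrict_family m n e = restrict_family m n f <->
  forall i, m <= i < n -> e i = f i.
Proof.
split=> [h i mi|h]; last first.
  by apply/ffunP => j; rewrite !ffunE h//; have := ltn_ord j; lia.
have i1 : i - m < n - m by lia.
have := congr1 (fun g : edges_between B m n => g (Ordinal i1)) h.
by rewrite !ffunE/= subnKC//; lia.
Qed.

Lemma restrict_family_onto m n (p : edges_between B m n) :
  exists e, p = restrict_family m n e.
Proof.
have [e0 _] := edge_family_exists.
(* At most one j satisfies m + j = i, so the edge at level i is forced up to a cast. Outside the
   range m <= i < n the arbitrary family [e0] fills in. *)
suff h i : exists e : edge B i, forall j : 'I_(n - m), forall E : m + j = i,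
    ecast i (edge B i) E (p j) = e.
  exists (fun i => projT1 (cid (h i))); apply/ffunP => j; rewrite ffunE.
  by case: cid => /= e /(_ j erefl).
case: (boolP (m <= i < n)) => mi; last first.
  by exists (e0 i) => j E; have := ltn_ord j; lia.
have i1 : i - m < n - m by lia.
have E1 : m + Ordinal i1 = i by rewrite /=; lia.
exists (ecast i (edge B i) E1 (p (Ordinal i1))) => j E.
have jE : j = Ordinal i1 by apply/val_inj => /=; lia.
by move: E1; rewrite -jE => E1; rewrite (eq_irrelevance E E1).
Qed.

(** Descent from the common end vertex: edges with the same end and the same rank coincide, hence so
    do their initial vertices, which are the ends of the edges one level below. *)
Lemma family_agree m n (v : vertex B n) e f :
  connected_between m n e -> family_ends_at m e v ->
  connected_between m n f -> family_ends_at m f v ->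
  forall i, m <= i < n -> (forall j, i < j < n -> rank (e j) = rank (f j)) ->
  tgt (e i) = tgt (f i) /\ forall j, i < j < n -> e j = f j.
Proof.
move=> ce ee cf ef i.
move: {2}(n - i) (leqnn (n - i)) => k; elim: k i => [|k IH] i; first lia.
move=> ik mi r; have [iE|ni] := eqVneq i.+1 n.
  split; last by move=> j; lia.
  have h : Tagged (vertex B) (tgt (e i)) = Tagged (vertex B) (tgt (f i)).
    by rewrite ee ?ef//; lia.
  exact: eq_from_Tagged h.
have [t a] := IH i.+1 (ltac:(lia)) (ltac:(lia)) (fun j ij => r j (ltac:(lia))).
have E : e i.+1 = f i.+1 by apply: rank_inj t (r _ _); lia.
split; first by rewrite ce ?cf ?E//; lia.
by move=> j ij; have [->//|nj] := eqVneq j i.+1; apply: a; lia.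
Qed.

(** By [family_agree], equal digits above level i force equal edges there and a common end at level
    i. The last differing edge is thus the highest differing digit, with the order reversed because
    ranks count bigger edges. *)
Lemma path_lt_code m n (v : vertex B n) e f :
  connected_between m n e -> family_ends_at m e v ->
  connected_between m n f -> family_ends_at m f v ->
  path_lt (restrict_family m n e) (restrict_family m n f) =
  (family_code m n f < family_code m n e).
Proof.
move=> ce ee cf ef; apply/idP/idP.
  move=> /path_ltE[i [mi lt eqj]]; apply/radix_value_ltP => //.
  - by move=> j; exact: rank_ltq.
  - by move=> j; exact: rank_ltq.
  - by exists i; split; [|exact: rank_lt_mono|move=> j /eqj ->].
move=> /radix_value_ltP -/(_ q_pos (fun i => rank_ltq tB _) (fun i => rank_ltq tB _)).
move=> [i [mi lt r]]; apply/path_ltE; exists i.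
have [t a] := family_agree ce ee cf ef mi (fun j h => esym (r j h)).
by split => //; rewrite (edge_ltE t).
Qed.

Lemma family_code_inj m n (v : vertex B n) e f :
  connected_between m n e -> family_ends_at m e v ->
  connected_between m n f -> family_ends_at m f v ->
  family_code m n e = family_code m n f ->
  forall i, m <= i < n -> e i = f i.
Proof.
move=> ce ee cf ef /radix_value_inj h i mi.
have {}h := h q_pos (fun i => rank_ltq tB _) (fun i => rank_ltq tB _).
have [t _] := family_agree ce ee cf ef mi (fun j ij => h j (ltac:(lia))).
exact: rank_inj t (h i mi).
Qed.

Lemma family_code_lt m n e : family_code m n e < qprod q m n.
Proof. by apply: radix_value_lt => // i _; exact: rank_ltq. Qed.

(** The family is built from the top: the edge into [v] with the prescribed rank fixes the vertex at
    which the remaining digits must end. [dfwith] overrides the family at that single level. *)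
Lemma family_of_digits n (v : vertex B n) (dg : nat -> nat) :
  (forall i, dg i < q i.+1) ->
  exists e, [/\ connected_between 0 n e, family_ends_at 0 e v &
             forall i, i < n -> rank (e i) = dg i].
Proof.
move=> dgq; elim: n v => [|n IH] v.
  by have [e _] := edge_family_exists; exists e; split => // i.
have [en tn rn] := rank_onto tB v (dgq n).
have [e [ce ee re]] := IH (src en).
exists (eqtype.dfwith e en); split.
- move=> i _ ni; rewrite dfwith_out; last by rewrite gtn_eqF//; lia.
  have [iE|ni'] := eqVneq i.+1 n; last first.
    by rewrite dfwith_out 1?eq_sym// ce//; lia.
  have := ee i (leq0n _) iE; move: en {tn rn ee}; rewrite -iE => en.
  by move=> E; rewrite (eq_from_Tagged E) dfwith_in.
- move=> i _ [->]; by rewrite dfwith_in tn.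
- move=> i ni; have [->|ne] := eqVneq i n; first by rewrite dfwith_in.
  by rewrite dfwith_out 1?eq_sym// re//; lia.
Qed.

Lemma family_of_code m n (v : vertex B n) c : c < qprod q m n ->
  exists e, [/\ connected_between m n e, family_ends_at m e v &
             family_code m n e = c].
Proof.
move=> /(radix_value_onto q_pos)[dg dgq dgc].
have [e [ce ee re]] := family_of_digits v dgq.
exists e; split.
- by move=> i _; exact: ce.
- by move=> i _; exact: ee.
- by rewrite -dgc; apply: eq_big_nat => i /andP[_ /re ->].
Qed.

Lemma path_connected m n (x : path_space B) : connected_between m n x.
Proof. by move=> i _ _; exact: path_edgeP. Qed.

Lemma path_ends_at m n (x : path_space B) : family_ends_at m x (tau n x).
Proof. by move=> i _ <-; rewrite path_edgeP. Qed.

(** A path with the same end is bigger than x exactly when its code is smaller, and every smaller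
    code belongs to exactly one path. The number of bigger paths is therefore the code of x
    itself. *)
Lemma suffix_countE m n (x : path_space B) :
  suffix_count m n x = family_code m n x.
Proof.
have cx := @path_connected m n x; have ex := @path_ends_at m n x.
pose N := family_code m n x.
have h (c : 'I_N) : exists e, [/\ connected_between m n e,
    family_ends_at m e (tau n x) & family_code m n e = c].
  by apply: family_of_code; exact: ltn_trans (ltn_ord c) (family_code_lt _ _ _).
pose e c := projT1 (cid (h c)).
have eP c : [/\ connected_between m n (e c),
    family_ends_at m (e c) (tau n x) & family_code m n (e c) = c].
  by rewrite /e; case: cid.
pose p c := restrict_family m n (e c).
have p_inj : injective p.
  move=> c c' /restrict_family_eq E; apply/val_inj => /=.
  have [_ _ <-] := eP c; have [_ _ <-] := eP c'.
  by apply: eq_big_nat => i /E ->.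
rewrite -/N -[N]card_ord -cardsT -(card_imset _ p_inj) /suffix_count.
apply: eq_card => r; rewrite inE; apply/idP/imsetP.
  have [f ->] := restrict_family_onto r.
  move=> /and3P[/is_pathE cf /ends_atE ef].
  rewrite (path_lt_code cx ex cf ef) => lt.
  exists (Ordinal lt) => //; apply/restrict_family_eq.
  have [ce ee cE] := eP (Ordinal lt).
  exact: family_code_inj cf ef ce ee (esym cE).
move=> [c _ ->]; have [ce ee cE] := eP c.
apply/and3P; split; [exact/is_pathE|exact/ends_atE|].
by rewrite (path_lt_code cx ex ce ee) cE.
Qed.

Lemma suffix_count_lt m n (x : path_space B) : suffix_count m n x < qprod q m n.
Proof. by rewrite suffix_countE family_code_lt. Qed.

Lemma suffix_count_cat l m n (x : path_space B) : l <= m -> m <= n ->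
  suffix_count l n x = suffix_count l m x + qprod q l m * suffix_count m n x.
Proof. by move=> lm mn; rewrite !suffix_countE; exact: radix_value_cat. Qed.

Lemma suffix_count_eq m n (x y : path_space B) :
  tau n x = tau n y -> suffix_count m n x = suffix_count m n y ->
  forall i, m <= i < n -> x i = y i.
Proof.
move=> t; rewrite !suffix_countE; apply: (@family_code_inj m n (tau n x)).
- exact: path_connected.
- exact: path_ends_at.
- exact: path_connected.
- rewrite t; exact: path_ends_at.
Qed.

Lemma eq_suffix_count m n (x y : path_space B) :
  (forall i, m <= i < n -> x i = y i) -> suffix_count m n x = suffix_count m n y.
Proof. by move=> h; rewrite !suffix_countE; apply: eq_big_nat => i /h ->. Qed.

End Paths.

(** * The Vershik map *)

Section Vershik.
Context (B : bratteli) (q : nat -> nat) (tB : toeplitz_type B q).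
Local Open Scope nat_scope.

Let q_pos := q_gt0 tB.

(** Minimality means having the largest code, and every value up to [(qprod q 0 k).-1] is the code
    of some path to the same vertex. *)
Lemma suffix_count_min_path k (y : path_space B) :
  is_min_path_to (segment 0 k y) (src (y k)) <->
  suffix_count 0 k y = (qprod q 0 k).-1.
Proof.
have cy := @path_connected B 0 k y; have ey := @path_ends_at B 0 k y.
have Q := qprod_gt0 q_pos 0 k.
split=> [[_ _ mn]|sE].
  have cq : (qprod q 0 k).-1 < qprod q 0 k by rewrite prednK.
  have [e [ce ee eE]] := family_of_code tB (tau k y) cq.
  have := mn (restrict_family 0 k e).
  have /is_pathE -> := ce; have /ends_atE -> := ee.
  move=> /(_ isT isT); rewrite (path_lt_code tB ce ee cy ey) -leqNgt eE => le.
  rewrite (suffix_countE tB); have := family_code_lt tB 0 k y; lia.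
split; [exact/is_pathE|exact/ends_atE|move=> p'].
have [e ->] := restrict_family_onto p'.
move=> /is_pathE ce /ends_atE ee; rewrite (path_lt_code tB ce ee cy ey).
rewrite -(suffix_countE tB) sE; have := family_code_lt tB 0 k e; lia.
Qed.

Lemma suffix_count1 n (x : path_space B) : suffix_count n n.+1 x = rank (x n).
Proof.
by rewrite (suffix_countE tB) /family_code radix_valueSr// radix_value0// qprodnn mul1n.
Qed.

Lemma suffix_count0_max n (x : path_space B) :
  suffix_count 0 n x = 0 <-> forall i, i < n -> max_edge (x i).
Proof.
elim: n => [|n IH]; first by rewrite (suffix_countE tB) /family_code radix_value0.
rewrite (suffix_count_cat tB x (leq0n n) (leqnSn n)).
rewrite suffix_count1.
have Q := qprod_gt0 q_pos 0 n.
split=> [h i|h].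
  have s0 : suffix_count 0 n x = 0 by lia.
  have r0 : rank (x n) = 0 by nia.
  rewrite ltnS leq_eqVlt => /orP[/eqP ->|]; first by rewrite max_edgeE r0.
  by move/IH : s0; exact.
have := h n (ltnSn n); rewrite max_edgeE => /eqP ->.
by rewrite muln0 addn0; apply/IH => i ni; exact/h/ltnW.
Qed.

(** The largest numeral has all its digits maximal, so its truncations are largest too. *)
Lemma suffix_count_full m n (y : path_space B) : m <= n ->
  suffix_count 0 n y = (qprod q 0 n).-1 -> suffix_count 0 m y = (qprod q 0 m).-1.
Proof.
move=> mn; rewrite (suffix_count_cat tB y (leq0n m) mn) -(qprodM q (leq0n m) mn).
have := suffix_count_lt tB 0 m y; have := suffix_count_lt tB m n y.
move: (suffix_count _ _ _) (suffix_count _ _ _) (qprod _ _ _) (qprod _ _ _).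
by move=> a c P Q; nia.
Qed.

(** This is subtraction of one with borrow. As s_n(x) > 0, the first non maximal edge has index k <
    n: the digits of x below k are 0, those of y are full, digit k drops by one and the others are
    kept. *)
Lemma vershik_rel_suffix_gt0 n (x y : path_space B) : vershik_rel x y ->
  0 < suffix_count 0 n x ->
  suffix_count 0 n x = (suffix_count 0 n y).+1 /\ forall i, n <= i -> y i = x i.
Proof.
move=> [[mx _]|[k [[mx nmx] sxy /suffix_count_min_path yk yx]]].
  by have -> : suffix_count 0 n x = 0 by apply/suffix_count0_max => i _; exact: mx.
case: (leqP n k) => nk.
  have -> // : suffix_count 0 n x = 0.
  by apply/suffix_count0_max => i ni; apply: mx; lia.
move=> _; split; last by move=> i ni; apply: yx; lia.
rewrite (suffix_count_cat tB x (leq0n k) (ltnW nk)).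
rewrite (suffix_count_cat tB y (leq0n k) (ltnW nk)) yk.
have -> : suffix_count 0 k x = 0 by apply/suffix_count0_max.
rewrite (suffix_count_cat tB x (leqnSn k) nk) (suffix_count_cat tB y (leqnSn k) nk).
rewrite -(eq_suffix_count tB (m := k.+1) (n := n) (x := y) (y := x)); last by move=> i /andP[ki _]; exact: yx.
rewrite !suffix_count1 (succ_edge_rank tB sxy).
have := qprod_gt0 q_pos 0 k; lia.
Qed.

(** Wrap-around: if the first n edges are maximal, the change happens at an index k >= n, below
    which y is minimal, or x is the maximal path and y is minimal everywhere. *)
Lemma vershik_rel_suffix0 n (x y : path_space B) : vershik_rel x y ->
  suffix_count 0 n x = 0 -> suffix_count 0 n y = (qprod q 0 n).-1.
Proof.
move=> [[mx mn]|[k [[mx nmx] sxy /suffix_count_min_path yk yx]]].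
  move=> _; apply/suffix_count_min_path; split.
  - exact/is_pathE/path_connected.
  - exact/ends_atE/path_ends_at.
  - move=> p _ _; have [e ->] := restrict_family_onto p.
    apply/negP => /path_ltE[i [_ lt _]].
    by move/forallP : (mn i) => /(_ (e i)); rewrite lt.
move=> /suffix_count0_max sx.
apply: suffix_count_full yk.
by rewrite leqNgt; apply/negP => /sx; rewrite (negbTE nmx).
Qed.

Lemma vershik_rel_exists (x : path_space B) :
  properly_ordered B -> exists y, vershik_rel x y.
Proof.
move=> [_ [m [mm _]]].
have [mx|] := pselect (max_path x); first by exists m; left.
move=> /existsNP[k0 /negP nk0].
have ex : exists k, ~~ max_edge (x k) by exists k0.
have [k nk least] := ex_minnP ex.
have mx i : i < k -> max_edge (x i).
  by move=> ik; apply/negP => /negP /least; lia.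
have [f sf] := succ_edge_exists tB nk.
have Q := qprod_gt0 q_pos 0 k.
have cq : (qprod q 0 k).-1 < qprod q 0 k by rewrite prednK.
have [e [ce ee eE]] := family_of_code tB (src f) cq.
(* The image has three pieces: the minimal path [e] to the source of [f] below k, the successor [f]
   at k, and the edges of x above k. *)
pose g i : edge B i := if i < k then e i else x i.
pose y : edge_family B := eqtype.dfwith g f.
have yk : y k = f by rewrite /y dfwith_in.
have ykT j : j = k -> Tagged (vertex B) (src (y j)) = Tagged (vertex B) (src f).
  by move=> ->; rewrite yk.
have ylt i : i < k -> y i = e i by move=> ik; rewrite /y dfwith_out ?gtn_eqF// /g ik.
have ygt i : k < i -> y i = x i.
  by move=> ik; rewrite /y dfwith_out ?ltn_eqF// /g ltnNge (ltnW ik).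
have yP i : tgt (y i) = src (y i.+1).
  case: (ltngtP i k) => ik.
  - rewrite ylt//; have [iE|ni] := eqVneq i.+1 k.
      exact: eq_from_Tagged (etrans (ee i (leq0n _) iE) (esym (ykT _ iE))).
    by rewrite ylt ?ce//; lia.
  - by rewrite !ygt ?path_edgeP//; lia.
  - by rewrite ik yk ygt// -path_edgeP; apply/esym/lt_tgt; case/andP: sf.
exists (Path yP); right; exists k; split => //=.
- by rewrite yk.
- apply/(suffix_count_min_path k (Path yP)); rewrite (suffix_countE tB) -eE.
  by apply: eq_big_nat => i /andP[_ ik] /=; rewrite ylt.
Qed.

Lemma vershikP (x : path_space B) : properly_ordered B -> vershik_rel x (vershik B x).
Proof.
move=> /(vershik_rel_exists x)[y xy]; rewrite /vershik; case: xgetP => [z _ //|/(_ y)].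
by move/(_ xy).
Qed.

End Vershik.

Section VershikTower.
Context (B : bratteli) (q : nat -> nat) (tB : toeplitz_type B q)
  (pB : properly_ordered B).
Local Open Scope nat_scope.
Implicit Types x y : path_space B.
Local Notation T := (vershik B).
Local Notation s n x := (suffix_count 0 n x).
Local Notation p n := (qprod q 0 n).

Lemma suffix_vershik n x : 0 < s n x -> s n x = (s n (T x)).+1.
Proof. by move=> /(vershik_rel_suffix_gt0 tB (vershikP tB x pB))[]. Qed.

Lemma tau_vershik n x : 0 < s n x -> tau n (T x) = tau n x.
Proof.
move=> /(vershik_rel_suffix_gt0 tB (vershikP tB x pB))[_ /(_ n (leqnn n))].
by rewrite /tau => ->.
Qed.

Lemma suffix_vershik0 n x : s n x = 0 -> s n (T x) = (p n).-1.
Proof. exact: vershik_rel_suffix0 (vershikP tB x pB). Qed.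

(** The bound [k.+1 < p n] excludes the wrap-around, after which the suffix count would be
    [(p n).-1]. *)
Lemma tower_preimage n (t : vertex B n) k x : k.+1 < p n ->
  (tau n (T x) = t /\ s n (T x) = k) <-> (tau n x = t /\ s n x = k.+1).
Proof.
move=> kp; have [s0|/[dup] s0] := posnP (s n x).
  by rewrite (suffix_vershik0 s0) s0; split=> -[_]; lia.
move=> /suffix_vershik ->; rewrite (tau_vershik s0).
by split=> -[-> E]; split=> //; lia.
Qed.

(** Modulo p_n the map T always lowers s_n by one, even when a point passes from one tower to
    another. *)
Lemma suffix_iter n j x : s n (iter j T x) + j = s n x %[mod p n].
Proof.
elim: j x => [|j IH] x; first by rewrite addn0.
rewrite iterSr addnS -addSn -[in RHS](addn0 (s n x)).
have [s0|s0] := posnP (s n x).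
  have := IH (T x); rewrite (suffix_vershik0 s0) s0 => h.
  rewrite addSn -addn1 -modnDml h modnDml addn1 prednK ?(qprod_gt0 (q_gt0 tB))//.
  by rewrite modnn mod0n.
have := IH (T x) => h; rewrite addSn -addn1 -modnDml h modnDml addn1 addn0.
by rewrite -suffix_vershik.
Qed.

Lemma suffix_iter_height n j x : s n (iter (j * p n) T x) = s n x.
Proof.
have := suffix_iter n (j * p n) x; rewrite addnC modnMDl.
by rewrite !modn_small ?(suffix_count_lt tB).
Qed.

End VershikTower.

(** * Cylinder sets and approximation of Borel sets *)

Section Topology.
Context (B : bratteli).
Local Notation X := (path_space B).
Implicit Types (x y : X) (U D : set X).

(** These are the unions of cylinders of length N, the clopen sets used for approximation. *)
Definition determined N D := forall x y, (forall i, (i < N)%N -> x i = y i) -> D x -> D y.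

Lemma cylinder_open c : open (@cylinder B c).
Proof.
exists [set cylinder c]; last by rewrite bigcup_set1.
by move=> _ ->; exact: finI_from1.
Qed.

Lemma open_cylinder U x : open U -> U x -> exists N, cylinder (x, N) `<=` U.
Proof.
move=> [D' sD <-] [A DA Ax].
(* A basic open set is a finite intersection of cylinders; around x it contains the cylinder of
   their maximal length. *)
have [F _ FA] := sD A DA; rewrite -FA in Ax.
pose s : seq (X * nat) := finmap.enum_fset F.
exists (\max_(c <- s) c.2)%N => y /= xy; exists A => //; rewrite -FA => c cF i ic.
rewrite xy; first exact: Ax.
by apply: leq_trans ic _; apply: (@leq_bigmax_seq _ s predT (fun c => c.2)).
Qed.

Lemma determined_open N D : determined N D -> open D.
Proof.
move=> dD.
have -> : D = \bigcup_(x in D) cylinder (x, N).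
  apply/seteqP; split => [x Dx|y [x Dx xy]]; first by exists x.
  by apply: dD Dx => i iN; rewrite xy.
by apply: bigcup_open => x _; exact: cylinder_open.
Qed.

Lemma determined_measurable N D : determined N D -> measurable (D : set (borel X)).
Proof. by move=> /determined_open oD; exact: sub_sigma_algebra. Qed.

End Topology.

(** * Approximation of Borel sets by clopen sets *)

Section Approximation.
Context (R : realType) (B : bratteli) (mu : probability (borel (path_space B)) R).
Local Notation X := (path_space B).
Local Notation P A := (fine (mu A)).
Implicit Types (A C : set (borel X)).

Lemma prE A : measurable A -> mu A = (P A)%:E.
Proof. by move=> mA; rewrite fineK// fin_num_measure. Qed.

Lemma pr_ge0 A : 0 <= P A.
Proof. exact: fine_ge0. Qed.

Lemma pr_le A C : measurable A -> measurable C -> A `<=` C -> P A <= P C.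
Proof.
move=> mA mC AC; rewrite -lee_fin -!prE//.
by apply: le_measure; rewrite ?inE.
Qed.

Lemma prT : P setT = 1.
Proof. by rewrite probability_setT. Qed.

Lemma pr0 : P set0 = 0.
Proof. by rewrite measure0. Qed.

Lemma pr_le1 A : measurable A -> P A <= 1.
Proof. by move=> mA; rewrite -prT; apply: pr_le. Qed.

Lemma prU A C : measurable A -> measurable C -> A `&` C = set0 ->
  P (A `|` C) = P A + P C.
Proof.
by move=> mA mC AC; rewrite measureU// fineD// fin_num_measure.
Qed.

Lemma prU_le A C : measurable A -> measurable C -> P (A `|` C) <= P A + P C.
Proof.
move=> mA mC.
have -> : A `|` C = A `|` (C `\` A).
  apply/seteqP; split => x /=; last by tauto.
  by have [Ax|nAx] := pselect (A x); tauto.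
have mD : measurable (C `\` A) by exact: measurableD.
have AD : A `&` (C `\` A) = set0 by rewrite setDE setICA setICr setI0.
by rewrite (prU mA mD AD) lerD2l; apply: pr_le => // x [].
Qed.

Lemma measurable_fibers (J : finType) (h : X -> J) A (r : seq J) :
  (forall j, measurable (A `&` [set x | h x = j])) ->
  measurable (A `&` [set x | h x \in r]).
Proof.
move=> mh; elim: r => [|j r IH].
  rewrite (_ : [set x | _] = set0) ?setI0//.
  by apply/seteqP; split => x //=; rewrite in_nil.
rewrite (_ : [set x | _] = [set x | h x = j] `|` [set x | h x \in r]).
  by rewrite setIUr; exact: measurableU.
apply/seteqP; split => x /=; rewrite inE; first by case/orP => [/eqP|]; [left|right].
by case=> [->|->]; rewrite ?eqxx ?orbT.
Qed.

Lemma measurable_of_fibers (J : finType) (h : X -> J) A :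
  (forall j, measurable (A `&` [set x | h x = j])) -> measurable A.
Proof.
move=> /(measurable_fibers (index_enum J)).
rewrite (_ : [set x | _] = setT) ?setIT//.
by apply/seteqP; split => x //= _; rewrite mem_index_enum.
Qed.

Lemma pr_partition (J : finType) (h : X -> J) A : measurable A ->
  (forall j, measurable ([set x | h x = j] : set (borel X))) ->
  P A = \sum_j P (A `&` [set x | h x = j]).
Proof.
move=> mA mh.
suff H (s : seq J) : uniq s ->
    P (A `&` [set x | h x \in s]) = \sum_(j <- s) P (A `&` [set x | h x = j]).
  have := H (index_enum J) (index_enum_uniq J).
  rewrite (_ : [set x | h x \in index_enum J] = setT) ?setIT//.
  by apply/seteqP; split => x //= _; rewrite mem_index_enum.
elim: s => [|j s IH] /=.
  rewrite big_nil (_ : [set x | h x \in [::]] = set0) ?setI0 ?pr0//.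
  by apply/seteqP; split => x //=; rewrite in_nil.
move=> /andP[js us]; rewrite big_cons -IH// -prU.
- congr (fine (mu _)); rewrite -setIUr; congr (_ `&` _).
  apply/seteqP; split => x /=; rewrite inE; first by case/orP => [/eqP|]; [left|right].
  by case=> [->|->]; rewrite ?eqxx ?orbT.
- exact: measurableI.
- by apply: measurable_fibers => i; exact: measurableI.
- apply/seteqP; split => x //= -[[_ hj] [_ hs]].
  by rewrite hj (negbTE js) in hs.
Qed.

Definition symdiff A C : set (borel X) := (A `\` C) `|` (C `\` A).

Definition approximable A := measurable A /\
  forall e : R, 0 < e -> exists N (C : set (borel X)),
    determined N C /\ P (symdiff A C) <= e.

Lemma measurable_symdiff A C : measurable A -> measurable C -> measurable (symdiff A C).
Proof. by move=> mA mC; apply: measurableU; exact: measurableD. Qed.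

Lemma pr_exhaust (V : nat -> set (borel X)) : (forall n, measurable (V n)) ->
  nondecreasing_seq V -> forall e : R, 0 < e ->
  exists N, P ((\bigcup_n V n) `\` V N) <= e.
Proof.
move=> mV ndV e e0.
have mU : measurable (\bigcup_n V n) by exact: bigcupT_measurable.
have : mu (V n) @[n --> \oo] --> (P (\bigcup_n V n))%:E.
  by rewrite fineK ?fin_num_measure//; exact: nondecreasing_cvg_mu.
move=> /fine_cvgP[_ /cvgrPdist_le/(_ e e0)].
move=> [N _ /(_ N (leqnn N))] /= h; exists N.
have VU : V N `<=` \bigcup_n V n by move=> x Vx; exists N.
have := prU (mV N) (measurableD mU (mV N)) (_ : V N `&` _ = set0).
rewrite setDUK// => /(_ (ltac:(by rewrite setDE setICA setICr setI0))) hU.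
by apply: le_trans (le_trans (ler_norm _) h); rewrite hU addrC addKr.
Qed.

Lemma approximable_open (U : set X) : open U -> approximable U.
Proof.
move=> oU; have mU : measurable (U : set (borel X)) by exact: sub_sigma_algebra.
split => // e e0.
(* [V N] is the union of the cylinders of length N contained in U; these sets increase to U. *)
pose V N : set (borel X) := [set x | cylinder (x, N) `<=` U].
have dV N : determined N (V N).
  by move=> x y xy Vx z /= zy; apply: Vx => i /= iN; rewrite zy// xy.
have mV N : measurable (V N) by exact: determined_measurable (dV N).
have VU N : V N `<=` U by move=> x; apply.
have UV : \bigcup_N V N = U.
  apply/seteqP; split => [x [N _ /VU]//|x Ux].
  by have [N xN] := open_cylinder oU Ux; exists N.
have ndV : nondecreasing_seq V.
  move=> m n mn; apply/subsetPset => x Vx y xy; apply: Vx => i /= im.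
  by apply: xy; exact: leq_trans mn.
have [N] := pr_exhaust mV ndV e0; rewrite UV => h.
exists N, (V N); split => //; rewrite /symdiff.
by rewrite (_ : V N `\` U = set0) ?setU0// setD_eq0.
Qed.

Lemma approximableC A : approximable A -> approximable (~` A).
Proof.
move=> [mA h]; split; first exact: measurableC.
move=> e /h[N [C [dC AC]]]; exists N, (~` C); split.
  by move=> x y xy Cx Cy; apply: Cx; apply: dC Cy => i /xy ->.
rewrite (_ : symdiff (~` A) (~` C) = symdiff A C)//; apply/seteqP; split => x;
  by rewrite /symdiff /=; have := pselect (A x); have := pselect (C x); tauto.
Qed.

Lemma symdiff_setU A A' C C' :
  symdiff (A `|` A') (C `|` C') `<=` symdiff A C `|` symdiff A' C'.
Proof. by move=> x; rewrite /symdiff /=; tauto. Qed.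

Lemma approximableU A A' : approximable A -> approximable A' ->
  approximable (A `|` A').
Proof.
move=> [mA h] [mA' h']; split; first exact: measurableU.
move=> e e0; have e20 : 0 < e / 2 by rewrite divr_gt0.
have [N [C [dC AC]]] := h _ e20; have [N' [C' [dC' AC']]] := h' _ e20.
exists (maxn N N'), (C `|` C'); split.
  move=> x y xy [Cx|Cx]; [left; apply: dC Cx|right; apply: dC' Cx] => i iN;
  by apply: xy; apply: leq_trans iN _; rewrite ?leq_maxl ?leq_maxr.
have mC := determined_measurable dC; have mC' := determined_measurable dC'.
have mS : measurable (symdiff A C) by exact: measurable_symdiff.
have mS' : measurable (symdiff A' C') by exact: measurable_symdiff.
apply: le_trans (pr_le _ _ (@symdiff_setU _ _ _ _)) _.
- by apply: measurable_symdiff; exact: measurableU.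
- exact: measurableU.
by apply: le_trans (prU_le _ _) _ => //; lra.
Qed.

(** Half of the error pays for truncating to a finite union, the other half for approximating that
    union. *)
Lemma approximable_bigcup (F : nat -> set (borel X)) :
  (forall n, approximable (F n)) -> approximable (\bigcup_n F n).
Proof.
move=> aF; pose V n : set (borel X) := \bigcup_(i in [set i | (i <= n)%N]) F i.
have VS n : V n.+1 = V n `|` F n.+1.
  apply/seteqP; split => x /=.
    move=> [i /=]; rewrite leq_eqVlt => /orP[/eqP ->|]; first by right.
    by rewrite ltnS => ni Fx; left; exists i.
  by move=> [[i /= ni Fx]|Fx]; [exists i => //=; exact: leqW|exists n.+1 => /=].
have aV n : approximable (V n).
  elim: n => [|n IH]; last by rewrite VS; exact: approximableU.
  rewrite (_ : V 0%N = F 0%N)//; apply/seteqP; split => x.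
    by move=> [i /=]; rewrite leqn0 => /eqP ->.
  by move=> Fx; exists 0%N.
have VF : \bigcup_n V n = \bigcup_n F n.
  apply/seteqP; split => x; first by move=> [n _ [i _ Fx]]; exists i.
  by move=> [n _ Fx]; exists n => //; exists n => /=.
have mV n : measurable (V n) by case: (aV n).
have ndV : nondecreasing_seq V.
  move=> m n mn; apply/subsetPset => x [i /= im Fx]; exists i => //=.
  exact: leq_trans mn.
rewrite -VF; have mU : measurable (\bigcup_n V n) by exact: bigcupT_measurable.
split => // e e0; have e20 : 0 < e / 2 by rewrite divr_gt0.
have [n hn] := pr_exhaust mV ndV e20.
have [_ /(_ _ e20)[N [C [dC AC]]]] := aV n; exists N, C; split => //.
have mC := determined_measurable dC.
apply: (@le_trans _ _ (P (((\bigcup_n V n) `\` V n) `|` symdiff (V n) C))).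
  apply: pr_le; first exact: measurable_symdiff.
    by apply: measurableU; [exact: measurableD|exact: measurable_symdiff].
  move=> x; rewrite /symdiff /= => -[[Ux Cx]|[Cx Ux]].
    by have [Vx|Vx] := pselect (V n x); [right; left|left].
  by right; right; split => // Vx; apply: Ux; exists n.
apply: le_trans (prU_le _ _) _; [exact: measurableD|exact: measurable_symdiff|lra].
Qed.

(** The approximable sets form a sigma-algebra containing the open sets, and [mA] says that A
    belongs to every such family. *)
Lemma borel_approximable A : measurable A -> approximable A.
Proof.
move=> mA; apply: (mA approximable); split; last exact: approximable_open.
split.
- exact/approximable_open/open0.
- by move=> C aC; rewrite setTD; exact: approximableC.
- exact: approximable_bigcup.
Qed.

End Approximation.

(** * Roots of unity *)

Section Expi.
Context (R : realType).
Implicit Types (x y : R).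

Lemma expi0 : expi (0 : R) = 1.
Proof. by rewrite /expi cos0 sin0. Qed.

Lemma expiD x y : expi (x + y) = expi x * expi y.
Proof.
apply/eqP; rewrite eq_complex /= cosD sinD eqxx/= addrC.
by rewrite [_ * sin y + _]addrC eqxx.
Qed.

Lemma expiX n x : expi x ^+ n = expi (n%:R * x).
Proof.
elim: n => [|n IH]; first by rewrite mul0r expi0.
by rewrite exprS IH -expiD -natr1 mulrDl mul1r addrC.
Qed.

Lemma expi_2pi : expi (2 * pi : R) = 1.
Proof. by rewrite /expi mulr_natl cos2pi sin2pi. Qed.

Lemma expi_2pi_int (k : int) : expi (2 * pi * k%:~R : R) = 1.
Proof.
have h n : expi (2 * pi * n%:R : R) = 1 by rewrite mulrC -expiX expi_2pi expr1n.
case: k => n; first exact: h.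
by rewrite NegzE -[LHS]mul1r -(h n.+1) -expiD mulrNz mulrN subrr expi0.
Qed.

(** Let m be the order of z and r the residue of a m modulo b. Then cos(2 pi r / b) = 1, so sin(pi r
    / b) = 0 by the double angle formula; since 0 <= r < b, r = 0. Coprimality turns b | a m into b
    | m. *)
Lemma expi_primitive (a : int) (b : nat) : (1 <= b)%N -> coprimez a b%:Z ->
  b.-primitive_root (expi (2 * pi * (a%:~R / b%:R)) : R[i]).
Proof.
move=> b1 ab; set z := expi _.
have bR : b%:R != 0 :> R by rewrite pnatr_eq0 -lt0n.
have zb : z ^+ b = 1.
  rewrite expiX -(expi_2pi_int a); congr expi; field; exact: bR.
have [m zm mb] := prim_order_exists b1 zb.
suff bm : (b %| m)%N.
  by have <- : m = b by apply/eqP; rewrite eqn_dvd mb.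
have := prim_expr_order zm; rewrite expiX.
pose r := (a * m%:Z %% b%:Z)%Z; pose k := (a * m%:Z %/ b%:Z)%Z.
have am : a%:~R * m%:R = k%:~R * b%:R + r%:~R :> R.
  by rewrite -[b%:R]/(b%:Z%:~R) -intrM -intrD -divz_eq intrM.
have -> : m%:R * (2 * pi * (a%:~R / b%:R)) = 2 * pi * ((a%:~R * m%:R) / b%:R) :> R by ring.
rewrite am; have -> : 2 * pi * ((k%:~R * b%:R + r%:~R) / b%:R) =
    2 * pi * k%:~R + (pi * (r%:~R / b%:R)) *+ 2 :> R by field.
rewrite expiD expi_2pi_int mul1r => /(congr1 (@complex.Re R)) /=; rewrite cos_mulr2n => h.
have {}h : sin (pi * (r%:~R / b%:R) : R) = 0.
  by apply/eqP; rewrite -sqrf_eq0 sin2cos2; apply/eqP; lra.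
have [r0|rn0] := eqVneq r 0.
  have : (b%:Z %| a * m%:Z)%Z by apply/dvdz_mod0P.
  by rewrite Gauss_dvdzr// coprimez_sym.
have b0 : (b%:Z != 0) by rewrite -lt0n in b1 *; lia.
have r_gt0 : 0 < r by rewrite lt_def rn0 modz_ge0.
have r_ltb : r < b%:Z by rewrite ltz_pmod//; lia.
have : 0 < sin (pi * (r%:~R / b%:R) : R).
  apply: sin_gt0_pi; rewrite mulr_gt0 ?pi_gt0 ?divr_gt0 ?ltr0z ?ltr0n//=.
  by rewrite gtr_pMr ?pi_gt0// ltr_pdivrMr ?ltr0n// mul1r -[b%:R]/(b%:Z%:~R) ltr_int.
by rewrite h ltxx.
Qed.

Lemma normcX (z : R[i]) n : normc (z ^+ n) = normc z ^+ n.
Proof. by elim: n => [|n IH]; [exact: normc1|rewrite !exprS normcM IH]. Qed.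

Lemma normc_ge0 (z : R[i]) : 0 <= normc z.
Proof. by case: z => u v; rewrite /normc sqrtr_ge0. Qed.

Lemma normc_prim_root b (z : R[i]) : b.-primitive_root z -> normc z = 1.
Proof.
move=> zb; have b0 := prim_order_gt0 zb.
apply/eqP; rewrite -(pexpr_eq1 b0 (normc_ge0 z)) -normcX (prim_expr_order zb).
by apply/eqP; exact: normc1.
Qed.

Lemma normc_sum (J : Type) (s : seq J) (Q : pred J) (F : J -> R[i]) :
  normc (\sum_(j <- s | Q j) F j) <= \sum_(j <- s | Q j) normc (F j).
Proof.
elim/big_ind2 : _ => [|u x v y ux vy|//]; first by rewrite normc0.
by apply: le_trans (le_normcD _ _) _; exact: lerD.
Qed.

End Expi.

Lemma sum_periodic_shift (V : nmodType) (b : nat) (h : nat -> V) :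
  h b = h 0%N -> \sum_(k < b) h k.+1 = \sum_(k < b) h k.
Proof.
case: b => [_|b hb]; first by rewrite !big_ord0.
by rewrite big_ord_recr big_ord_recl/= hb addrC.
Qed.

(** * Measures of towers *)

Lemma continuous_borel (X : ptopologicalType) (g : X -> X) (A : set (borel X)) :
  continuous g -> measurable A -> measurable (g @^-1` A : set (borel X)).
Proof.
move=> cg mA; apply: (mA (fun C => measurable (g @^-1` C : set (borel X)))); split.
  split => [|C|F].
  - by rewrite preimage_set0.
  - by rewrite setTD preimage_setC; exact: measurableC.
  - by rewrite preimage_bigcup; exact: bigcupT_measurable.
move=> U oU; apply: sub_sigma_algebra.
by move/continuousP : cg; exact.
Qed.

Section Towers.
Context (R : realType) (B : bratteli) (q : nat -> nat) (tB : toeplitz_type B q)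
  (pB : properly_ordered B) (cT : continuous (vershik B))
  (mu : probability (borel (path_space B)) R)
  (muT : forall A : set (borel (path_space B)), measurable A ->
    mu (vershik B @^-1` A) = mu A).
Local Notation X := (path_space B).
Local Notation T := (vershik B).
Local Notation P A := (fine (mu A)).
Local Notation s n x := (suffix_count 0 n x).
Local Notation p n := (qprod q 0 n).
Implicit Types (A C : set (borel X)).

Let q_pos := q_gt0 tB.

Lemma measurable_vershik A : measurable A -> measurable (T @^-1` A : set (borel X)).
Proof. exact: continuous_borel. Qed.

Lemma measurable_iter j A : measurable A ->
  measurable (iter j T @^-1` A : set (borel X)).
Proof.
elim: j A => [|j IH] A mA //.
rewrite (_ : _ @^-1` A = iter j T @^-1` (T @^-1` A)); last first.
  by apply/seteqP; split => x.
by apply: IH; exact: measurable_vershik.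
Qed.

Lemma mu_iter j A : measurable A -> mu (iter j T @^-1` A) = mu A.
Proof.
elim: j A => [|j IH] A mA //.
rewrite (_ : _ @^-1` A = iter j T @^-1` (T @^-1` A)); last first.
  by apply/seteqP; split => x.
by rewrite IH ?muT//; exact: measurable_vershik.
Qed.

(** Floor [k] of the tower of level n over [t]. As T lowers suffix counts, it moves points down the
    tower. *)
Definition atom n (t : vertex B n) k : set (borel X) :=
  [set x | tau n x = t /\ s n x = k].

Lemma tau_determined n (t : vertex B n) : determined n.+1 [set x : X | tau n x = t].
Proof. by move=> x y xy /=; rewrite /tau xy. Qed.

Lemma suffix_determined m n k : determined n [set x : X | suffix_count m n x = k].
Proof.
move=> x y xy /=; rewrite (@eq_suffix_count B q tB m n x y)// => i /andP[_ ni].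
exact: xy.
Qed.

Lemma measurable_tau n (t : vertex B n) :
  measurable ([set x | tau n x = t] : set (borel X)).
Proof. exact: determined_measurable (@tau_determined n t). Qed.

Lemma measurable_suffix m n k :
  measurable ([set x : X | suffix_count m n x = k] : set (borel X)).
Proof. exact: determined_measurable (@suffix_determined m n k). Qed.

Lemma measurable_atom n (t : vertex B n) k : measurable (atom t k).
Proof. by apply: measurableI; [exact: measurable_tau|exact: measurable_suffix]. Qed.

Lemma atom_preimage n (t : vertex B n) k : (k.+1 < p n)%N ->
  T @^-1` (atom t k) = atom t k.+1.
Proof.
by move=> kp; apply/seteqP; split => x /= h; apply/(tower_preimage tB pB t x kp).
Qed.

(** Stated for any family that T carries from floor to floor, so that it applies to parts of floors
    as well as to whole floors. *)
Lemma tower_const n (D : nat -> set (borel X)) :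
  (forall k, measurable (D k)) ->
  (forall k, (k.+1 < p n)%N -> T @^-1` (D k) = D k.+1) ->
  forall k l, (k < p n)%N -> (l < p n)%N -> P (D k) = P (D l).
Proof.
move=> mD DT.
suff h k : (k < p n)%N -> P (D k) = P (D 0%N) by move=> k l /h -> /h ->.
elim: k => [//|k IH] kp; rewrite -(DT _ kp) muT//.
exact/IH/ltnW.
Qed.

Lemma pr_suffix_sum m n A : measurable A ->
  P A = \sum_(k < qprod q m n) P (A `&` [set x | suffix_count m n x = k]).
Proof.
move=> mA; pose h (x : X) := Ordinal (suffix_count_lt tB m n x).
have hE (j : 'I_(qprod q m n)) : [set x | h x = j] = [set x | suffix_count m n x = j].
  by apply/seteqP; split => x /=; [move=> <-|move=> E; apply/val_inj].
rewrite (pr_partition mu (h := h) mA); last first.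
  by move=> j; rewrite hE; exact: measurable_suffix.
by apply: eq_bigr => j _; rewrite hE.
Qed.

Lemma pr_tau_sum n A : measurable A ->
  P A = \sum_(t : vertex B n) P (A `&` [set x | tau n x = t]).
Proof. by move=> mA; apply: pr_partition => // t; exact: measurable_tau. Qed.

Lemma atom_pr n (t : vertex B n) k : (k < p n)%N ->
  P (atom t k) * (p n)%:R = P [set x | tau n x = t].
Proof.
move=> kp; rewrite (pr_suffix_sum 0 n (measurable_tau t)).
rewrite (eq_bigr (fun=> P (atom t k))); last first.
  move=> l _; have := @tower_const n (atom t) (fun k => measurable_atom t k).
  by move=> /(_ (fun k => @atom_preimage n t k) l k) -> //.
by rewrite sumr_const card_ord mulr_natr.
Qed.

(** The set is the union of the p_m floors r + p_m k with r < p_m, each of measure mu(tau_n = t) /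
    p_n, and p_n = p_m q_{m,n}. *)
Lemma suffix_pr m n (t : vertex B n) k : (m <= n)%N -> (k < qprod q m n)%N ->
  P ([set x | tau n x = t] `&` [set x | suffix_count m n x = k]) * (qprod q m n)%:R =
  P [set x | tau n x = t].
Proof.
move=> mn kq; have mA : measurable ([set x | tau n x = t] `&`
    [set x | suffix_count m n x = k] : set (borel X)).
  by apply: measurableI; [exact: measurable_tau|exact: measurable_suffix].
have pM := qprodM q (leq0n m) mn.
have rk (r : 'I_(p m)) : (r + p m * k < p n)%N.
  by rewrite -pM; have := ltn_ord r; nia.
have p0 : (p n)%:R != 0 :> R by rewrite pnatr_eq0 -lt0n qprod_gt0.
rewrite (pr_suffix_sum 0 m mA) (eq_bigr (fun=> P [set x | tau n x = t] / (p n)%:R)).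
  rewrite sumr_const card_ord -mulr_natr -pM natrM.
  have : (p m)%:R != 0 :> R by rewrite pnatr_eq0 -lt0n qprod_gt0.
  have : (qprod q m n)%:R != 0 :> R by rewrite pnatr_eq0 -lt0n qprod_gt0.
  by move=> h1 h2; field; rewrite h1.
move=> r _; rewrite -(atom_pr t (rk r)) mulfK//; congr (fine (mu _)).
have sE x := suffix_count_cat tB x (leq0n m) mn.
apply/seteqP; split => x /=; first by move=> [[<- h1] h2]; split=> //; rewrite sE h1 h2.
move=> [<-]; rewrite sE => h; have := suffix_count_lt tB 0 m x.
have := ltn_ord r; move: h; move: (suffix_count _ _ _) (suffix_count _ _ _) => v u h ur up.
have Q0 := qprod_gt0 q_pos 0 m.
have uk : v = k.
  have := congr1 (divn^~ (p m)) h; rewrite (addnC u) (addnC r) !(mulnC (p m)).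
  by rewrite !divnMDl// !divn_small// !addn0.
by move: h; rewrite uk => /addIn ->; split.
Qed.

(** The set where T leaves a tower has measure 1 / p_n; this bounds the boundary errors in
    [residue_set_shift]. *)
Lemma pr_suffix0 n : P [set x | s n x = 0%N] * (p n)%:R = 1.
Proof.
rewrite (pr_tau_sum n (measurable_suffix 0 n 0)) mulr_suml.
rewrite (eq_bigr (fun t => P ([set: borel X] `&` [set x | tau n x = t]))); last first.
  move=> t _; rewrite setTI -(@atom_pr n t 0) ?qprod_gt0//; congr (fine (mu _) * _).
  by rewrite setIC.
by rewrite -pr_tau_sum// prT.
Qed.

End Towers.

Lemma prim_root_neq0 (F : fieldType) b (z : F) : b.-primitive_root z -> z != 0.
Proof.
move=> zP; apply/eqP => z0; have := prim_expr_order zP.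
by rewrite z0 expr0n gtn_eqF ?(prim_order_gt0 zP)// => /eqP; rewrite eq_sym oner_eq0.
Qed.

(** For disjoint sets this is the function equal to [lam ^- k] on [A k] and to 0 elsewhere. Written
    as a sum it remains meaningful for clopen approximations of these sets, which may overlap. *)
Definition phase_sum (K : unitRingType) (X : Type) b (lam : K) (A : nat -> set X) x : K :=
  \sum_(k < b) lam ^- k * (`[< A k x >])%:R.

(** * Eigenfunctions with finitely many values *)

Section FundamentalDomain.
Context (R : realType) (b : nat) (lam : R[i]) (lamP : b.-primitive_root lam).

(** The lexicographic order is total, so every finite orbit has a largest point. *)
Definition lexC (z : R[i]) : (R *l R)%type := (complex.Re z, complex.Im z).

Lemma lexC_inj : injective lexC.
Proof. by move=> [u v] [u' v'] [-> ->]. Qed.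

(* Contains exactly one point of each nonzero orbit under multiplication by
   [lam]: the lexicographically largest one. *)
Definition fund_domain (z : R[i]) : Prop :=
  z <> 0 /\ forall j, (lexC (lam ^+ j * z) <= lexC z)%O.

Lemma fund_domain_exists z : z <> 0 -> exists k : 'I_b, fund_domain (lam ^+ k * z).
Proof.
move=> z0; have b0 := prim_order_gt0 lamP.
have lam0 k : lam ^+ k != 0 by rewrite expf_neq0// (prim_root_neq0 lamP).
pose k := [arg max_(k > Ordinal b0) lexC (lam ^+ (k : 'I_b) * z)]%O.
exists k; split; first by apply/eqP; rewrite mulf_neq0 ?lam0//; exact/eqP.
move=> j; rewrite /k; case: arg_maxP => // i _ h.
rewrite mulrA -exprD -(prim_expr_mod lamP).
exact: (h (Ordinal (ltn_pmod (j + i) b0))).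
Qed.

Lemma fund_domain_uniq z k l : (k < b)%N -> (l < b)%N ->
  fund_domain (lam ^+ k * z) -> fund_domain (lam ^+ l * z) -> k = l.
Proof.
suff h k' l' : (l' < b)%N -> fund_domain (lam ^+ l' * z) ->
    (lexC (lam ^+ k' * z) <= lexC (lam ^+ l' * z))%O.
  move=> kb lb dk dl.
  have /lexC_inj E : lexC (lam ^+ k * z) = lexC (lam ^+ l * z).
    by apply/le_anti; rewrite !h.
  have z0 : z != 0 by apply/eqP => z0; case: dk; rewrite z0 mulr0.
  have /eqP := mulIf z0 E; rewrite (eq_prim_root_expr lamP) !modn_small//.
  by move=> /eqP.
(* Since [lam ^+ b = 1], multiplication by [lam ^+ (b - l' + k')] takes [lam ^+ l' * z] to
   [lam ^+ k' * z]. *)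
move=> lb [_ /(_ (b - l' + k')%N)]; rewrite mulrA -exprD addnAC subnK ?(ltnW lb)//.
by rewrite exprD (prim_expr_order lamP) mul1r.
Qed.

Local Notation phase := (phase_sum b lam (fun k z => fund_domain (lam ^+ k * z))).

(** Multiplying z by [lam] shifts the index of the sets by one, and the summand is periodic of
    period b. *)
Lemma phase_mul z : phase (lam * z) = lam * phase z.
Proof.
pose h k := lam ^- k * (`[< fund_domain (lam ^+ k * z) >])%:R.
rewrite /phase_sum (eq_bigr (fun k : 'I_b => lam * h k.+1)); last first.
  move=> k _; rewrite /h mulrA -exprSr [in RHS]exprS invfM !mulrA divff ?mul1r -?exprS//.
  exact: prim_root_neq0 lamP.
rewrite -mulr_sumr sum_periodic_shift//.
by rewrite /h (prim_expr_order lamP) expr0.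
Qed.

Lemma phase_eq0 z : phase z = 0 -> z = 0.
Proof.
move=> pz; apply: contrapT => z0; have [k dk] := fund_domain_exists z0.
move: pz; rewrite /phase_sum (bigD1 k)//= big1 => [|l lk].
  rewrite asboolT//= addr0 mulr1 => /eqP; rewrite invr_eq0 expf_eq0.
  by rewrite (negbTE (prim_root_neq0 lamP)) andbF.
rewrite asboolF ?mulr0// => dl; move/eqP: lk; apply; apply/val_inj.
exact: (fund_domain_uniq (ltn_ord l) (ltn_ord k) dl dk).
Qed.

End FundamentalDomain.

Section ComplexMeasurable.
Context (R : realType) d (X : measurableType d).
Implicit Types f g : X -> R[i].

Definition cmeasurable f :=
  measurable_fun setT (fun x => complex.Re (f x)) /\
  measurable_fun setT (fun x => complex.Im (f x)).

Lemma cmeasurable_scale c f : cmeasurable f -> cmeasurable (fun x => c * f x).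
Proof.
case: c => u v [mr mi]; split.
  rewrite (_ : (fun _ => _) = (fun x => u * complex.Re (f x) - v * complex.Im (f x))).
    by apply: measurable_funB; apply: measurable_funM.
  by apply/funext => x; case: (f x).
rewrite (_ : (fun _ => _) = (fun x => u * complex.Im (f x) + v * complex.Re (f x))).
  by apply: measurable_funD; apply: measurable_funM.
by apply/funext => x; case: (f x).
Qed.

Lemma measurable_le_fun (u v : X -> R) : measurable_fun setT u ->
  measurable_fun setT v -> measurable [set x | u x <= v x].
Proof.
move=> mu mv; rewrite (_ : mkset _ = (fun x => v x - u x) @^-1` `[0, +oo[).
  by rewrite -[_ @^-1` _]setTI; apply: measurable_funB => //; exact: measurable_itv.
by apply/seteqP; split => x /=; rewrite in_itv/= andbT subr_ge0.
Qed.

Lemma measurable_lexC_le f g : cmeasurable f -> cmeasurable g ->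
  measurable [set x | (lexC (f x) <= lexC (g x))%O].
Proof.
move=> [fr fi] [gr gi].
rewrite (_ : mkset _ = [set x | complex.Re (f x) <= complex.Re (g x)] `&`
   (~` [set x | complex.Re (g x) <= complex.Re (f x)] `|`
     [set x | complex.Im (f x) <= complex.Im (g x)])).
  apply: measurableI; first exact: measurable_le_fun.
  by apply: measurableU; [apply: measurableC|]; exact: measurable_le_fun.
apply/seteqP; split => x /=; rewrite Order.ProdLexiOrder.leEprodlexi /=.
  move=> /andP[-> /implyP h]; split => //.
  by have [/h|] := pselect (complex.Re (g x) <= complex.Re (f x)); [right|left].
move=> [-> h] /=; apply/implyP => le.
by case: h.
Qed.

Lemma measurable_eq0 f : cmeasurable f -> measurable [set x | f x = 0].
Proof.
move=> mf; have m0 : cmeasurable (fun=> 0) by split; exact: measurable_cst.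
rewrite (_ : mkset _ = [set x | (lexC (f x) <= lexC 0)%O] `&`
   [set x | (lexC 0 <= lexC (f x))%O]).
  by apply: measurableI; exact: measurable_lexC_le.
apply/seteqP; split => x /= => [->|[h h']]; first by rewrite lexx.
by apply: lexC_inj; apply/le_anti; rewrite h h'.
Qed.

Lemma measurable_fund_domain lam f : cmeasurable f ->
  measurable [set x | fund_domain lam (f x)].
Proof.
move=> mf; rewrite (_ : mkset _ = ~` [set x | f x = 0] `&`
  \bigcap_j [set x | (lexC (lam ^+ j * f x) <= lexC (f x))%O]).
  apply: measurableI; first exact/measurableC/measurable_eq0.
  apply: bigcapT_measurable => j; apply: measurable_lexC_le => //.
  exact: cmeasurable_scale.
by apply/seteqP; split => x /= [h h']; split => //; [move=> j _|move=> j]; exact: h'.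
Qed.

End ComplexMeasurable.

Section Quantization.
Context (R : realType) (X : ptopologicalType) (T : X -> X) (cT : continuous T)
  (S : X -> X) (cS : continuous S) (TK : cancel T S)
  (mu : probability (borel X) R) (erg : ergodic T mu)
  (b : nat) (lam : R[i]) (lamP : b.-primitive_root lam).

Let muT (A : set (borel X)) : measurable A -> mu (T @^-1` A) = mu A.
Proof. exact: erg.1. Qed.

Let muS (A : set (borel X)) : measurable A -> mu (S @^-1` A) = mu A.
Proof.
move=> mA; rewrite -muT; last exact: continuous_borel.
by congr (mu _); apply/seteqP; split => x /=; rewrite TK.
Qed.

(** The hull is the union of all preimages of N under the iterates of T and of its inverse S, each
    of measure 0. *)
Lemma negligible_invariant_hull (N : set (borel X)) : measurable N -> mu N = 0%E ->
  exists N', [/\ measurable N', mu N' = 0%E, N `<=` N' & T @^-1` N' = N'].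
Proof.
move=> mN N0.
pose FT n : set (borel X) := iter n T @^-1` N.
pose FS n : set (borel X) := iter n S @^-1` N.
have FTS n : FT n.+1 = T @^-1` FT n by apply/seteqP; split => x; rewrite /FT /= -iterSr.
have FSS n : FS n.+1 = S @^-1` FS n by apply/seteqP; split => x; rewrite /FS /= -iterSr.
have mFT n : measurable (FT n) /\ mu (FT n) = 0%E.
  elim: n => [//|n [m0 h0]]; rewrite FTS; split; first exact: continuous_borel.
  by rewrite muT.
have mFS n : measurable (FS n) /\ mu (FS n) = 0%E.
  elim: n => [//|n [m0 h0]]; rewrite FSS; split; first exact: continuous_borel.
  by rewrite muS.
have neg (F : nat -> set (borel X)) : (forall n, measurable (F n) /\ mu (F n) = 0%E) ->
    measurable (\bigcup_n F n) /\ mu.-negligible (\bigcup_n F n).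
  move=> mF; split; first by apply: bigcupT_measurable => n; case: (mF n).
  by apply: negligible_bigcup => n; have [? ?] := mF n; exact/negligibleP.
have [mT nT] := neg _ mFT; have [mS nS] := neg _ mFS.
exists (\bigcup_n FT n `|` \bigcup_n FS n); split.
- exact: measurableU.
- by apply/negligibleP; [exact: measurableU|exact: negligibleU].
- by move=> x Nx; left; exists 0%N.
- apply/seteqP; split => x /=.
    move=> [[n _]|[[|n] _]].
    + by rewrite /FT /= -iterSr => h; left; exists n.+1.
    + by rewrite /FS /= => h; left; exists 1%N.
    + by rewrite FSS /= TK => h; right; exists n.
  move=> [[[|n] _]|[n _]].
  + by rewrite /FT /= => h; right; exists 1%N => //; rewrite /FS /= TK.
  + by rewrite FTS /= => h; left; exists n.
  + by move=> h; right; exists n.+1 => //; rewrite FSS /= TK.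
Qed.

(** The new function is the phase of f: [A k] collects the points where [lam ^+ k * f x] lies in the
    fundamental domain. The zero set of f, enlarged by an invariant null set, is invariant, so
    ergodicity makes it null since f is not zero almost everywhere. *)
Lemma quantized_eigenfunction : eigenvalue_for T mu lam ->
  exists A : nat -> set (borel X), (forall k, measurable (A k)) /\
    (forall x, phase_sum b lam A (T x) = lam * phase_sum b lam A x) /\
    exists Z, [/\ measurable Z, mu Z = 0%E & forall x, phase_sum b lam A x = 0 -> Z x].
Proof.
move=> [f [[mr mi _] fN0 fT]].
have mf : @cmeasurable R _ (borel X) f by [].
have lam0 : lam != 0 := prim_root_neq0 lamP.
have [N0 [mN0 N00 N0f]] := fT.
have [N [mN NN0 N0N TN]] := negligible_invariant_hull mN0 N00.
have TNx x : N (T x) <-> N x by rewrite -[N in X in _ <-> X]TN.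
have fTN x : ~ N x -> f (T x) = lam * f x.
  by move=> Nx; apply: contrapT => h; apply/Nx/N0N/N0f.
pose Z : set (borel X) := N `|` [set x | f x = 0].
have mZ : measurable Z by apply: measurableU => //; exact: measurable_eq0.
have TZ : T @^-1` Z = Z.
  apply/seteqP; split => x; rewrite /Z /= TNx.
    have [Nx _|Nx [//|]] := pselect (N x); first by left.
    by rewrite fTN// => /eqP; rewrite mulf_eq0 (negbTE lam0) => /eqP; right.
  have [Nx _|Nx [//|fx]] := pselect (N x); first by left.
  by right; rewrite fTN// fx mulr0.
have Z0 : mu Z = 0%E.
  have [//|Z1] := erg.2 _ mZ TZ; exfalso; apply: fN0.
  have CZ : mu (~` Z) = 0%E by rewrite probability_setC// Z1 subee.
  exists (~` Z `|` N); split.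
  - by apply: measurableU => //; exact: measurableC.
  - by rewrite measureU0 ?NN0//; exact: measurableC.
  - by move=> x /= fx; have [Nx|Nx] := pselect (N x); [right|left => -[]].
(* Removing N makes the phase sum vanish on N, so the eigenvalue equation holds at every point and
   not only almost everywhere. *)
exists (fun k => ~` N `&` [set x | fund_domain lam (lam ^+ k * f x)]); split.
  move=> k; apply: measurableI; first exact: measurableC.
  by apply: measurable_fund_domain; exact: cmeasurable_scale.
split; last first.
  exists Z; split => // x; have [Nx|Nx] := pselect (N x); first by left.
  move=> h; right; apply: (phase_eq0 lamP); rewrite -[RHS]h.
  apply: eq_bigr => k _; congr (_ * (nat_of_bool _)%:R).
  by apply: asbool_equiv_eq; split => [|[]//]; split.
move=> x; have [Nx|Nx] := pselect (N x).
  rewrite /phase_sum !big1 ?mulr0// => k _; rewrite asboolF ?mulr0// => -[]; rewrite /= ?TNx//.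
have E y : ~ N y -> phase_sum b lam (fun k => ~` N `&`
    [set x | fund_domain lam (lam ^+ k * f x)]) y =
    phase_sum b lam (fun k z => fund_domain lam (lam ^+ k * z)) (f y).
  move=> Ny; apply: eq_bigr => k _; congr (_ * (nat_of_bool _)%:R).
  by apply: asbool_equiv_eq; split => [[]//|]; split.
by rewrite !E ?TNx// fTN// phase_mul.
Qed.

End Quantization.

(** The sum takes finitely many values, each on a measurable set, so [Y] may be arbitrary. *)
Lemma measurable_indic_sum d (X : measurableType d) (K : nzRingType)
    (A : nat -> set X) (z : nat -> K) n (Y : set K) :
  (forall k, measurable (A k)) ->
  measurable [set x | Y (\sum_(k < n) z k * (`[< A k x >])%:R)].
Proof.
move=> mA; elim: n Y => [|n IH] Y.
  have [Y0|Y0] := pselect (Y 0).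
    by rewrite (_ : mkset _ = setT)//; apply/seteqP; split => x //= _; rewrite big_ord0.
  by rewrite (_ : mkset _ = set0)//; apply/seteqP; split => x //=; rewrite big_ord0.
rewrite (_ : mkset _ =
  (A n `&` [set x | [set y | Y (y + z n)] (\sum_(k < n) z k * (`[< A k x >])%:R)])
  `|` (~` A n `&` [set x | Y (\sum_(k < n) z k * (`[< A k x >])%:R)])).
  by apply: measurableU; apply: measurableI => //; exact: measurableC.
apply/seteqP; split => x /=; rewrite big_ord_recr/=.
  have [Ax|Ax] := pselect (A n x); first by rewrite asboolT// mulr1; left.
  by rewrite asboolF// mulr0 addr0; right.
by move=> [[Ax]|[Ax]]; [rewrite asboolT// mulr1|rewrite asboolF// mulr0 addr0].
Qed.

(** * Approximation of an eigenfunction along the towers *)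

Section Coherence.
Context (R : realType) (B : bratteli) (q : nat -> nat) (tB : toeplitz_type B q)
  (pB : properly_ordered B)
  (mu : probability (borel (path_space B)) R)
  (muT : forall A : set (borel (path_space B)), measurable A ->
    mu (vershik B @^-1` A) = mu A).
Local Notation X := (path_space B).
Local Notation T := (vershik B).
Local Notation P A := (fine (mu A)).
Local Notation s n x := (suffix_count 0 n x).
Local Notation p n := (qprod q 0 n).
Implicit Types (C : set (borel X)).

Let q_pos := q_gt0 tB.

Lemma pr_bigcup_le (D : nat -> set (borel X)) n : (forall k, measurable (D k)) ->
  measurable (\bigcup_(k in [set k | (k < n)%N]) D k) /\
  P (\bigcup_(k in [set k | (k < n)%N]) D k) <= \sum_(k < n) P (D k).
Proof.
move=> mD; elim: n => [|n [m h]].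
  rewrite (_ : \bigcup_(k in _) _ = set0) ?big_ord0 ?pr0//.
  by apply/seteqP; split => x // -[k].
rewrite (_ : \bigcup_(k in _) _ = \bigcup_(k in [set k | (k < n)%N]) D k `|` D n).
  split; first exact: measurableU.
  by apply: le_trans (prU_le mu m (mD n)) _; rewrite big_ord_recr/= lerD2r.
apply/seteqP; split => x /=.
  move=> [k /=]; rewrite ltnS leq_eqVlt => /orP[/eqP ->|kn Dx]; first by right.
  by left; exists k.
by move=> [[k /= kn Dx]|Dx]; [exists k => //=; exact: ltnW|exists n => /=].
Qed.

Definition tower_coord n (x : X) : vertex B n * 'I_(p n) :=
  (tau n x, Ordinal (suffix_count_lt tB 0 n x)).

Lemma tower_coordE n tk : [set x | tower_coord n x = tk] = atom tk.1 tk.2.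
Proof.
case: tk => t k; apply/seteqP; split => x /=; first by move=> [<- <-].
by rewrite /tower_coord => -[<- E]; congr (_, _); apply/val_inj.
Qed.

Lemma pr_atom_sum n C : measurable C ->
  P C = \sum_(tk : vertex B n * 'I_(p n)) P (C `&` atom tk.1 tk.2).
Proof.
move=> mC; rewrite (pr_partition mu (h := tower_coord n) mC); last first.
  by move=> j; rewrite tower_coordE; exact: measurable_atom.
by apply: eq_bigr => tk _; rewrite tower_coordE.
Qed.

Context (b : nat) (lam : R[i]) (lamP : b.-primitive_root lam).
Context (A : nat -> set (borel X)) (mA : forall k, measurable (A k)).
Local Notation F := (phase_sum b lam A).
Context (FT : forall x, F (T x) = lam * F x).

(** Each of the b level sets is replaced by a clopen set at cost e / b; off the union of the
    symmetric differences both phase sums agree. *)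
Lemma quantized_approximation (e : R) : 0 < e -> exists N (Phi : X -> R[i]) C,
  [/\ forall x y : X, (forall i, (i < N)%N -> x i = y i) -> Phi x = Phi y,
      measurable C, P C <= e & forall x, F x <> Phi x -> C x].
Proof.
move=> e0; have b0 := prim_order_gt0 lamP.
have eb : 0 < e / b%:R by rewrite divr_gt0// ltr0n.
have h k : exists NC : nat * set (borel X),
    determined NC.1 NC.2 /\ P (symdiff (A k) NC.2) <= e / b%:R.
  have [_ /(_ _ eb)[N [C h]]] := borel_approximable mu (mA k).
  by exists (N, C).
have [NC NCP] := choice h.
have mC k : measurable (NC k).2 by case: (NCP k) => /determined_measurable.
have mS k : measurable (symdiff (A k) (NC k).2) by exact: measurable_symdiff.
have [mU PU] := @pr_bigcup_le (fun k => symdiff (A k) (NC k).2) b mS.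
exists (\max_(k < b) (NC k).1), (phase_sum b lam (fun k => (NC k).2)),
  (\bigcup_(k in [set k | (k < b)%N]) symdiff (A k) (NC k).2); split => //.
- move=> x y xy; apply: eq_bigr => k _; congr (_ * (nat_of_bool _)%:R).
  have [dC _] := NCP k.
  have xyk i : (i < (NC k).1)%N -> x i = y i.
    by move=> ik; apply: xy; apply: leq_trans ik _; exact: leq_bigmax.
  apply: asbool_equiv_eq; split; apply: dC => i ik; rewrite xyk//.
- apply: le_trans PU _; rewrite -[leRHS](@divfK _ b%:R) ?pnatr_eq0 -?lt0n//.
  rewrite mulr_natr -[X in _ *+ X]card_ord -sumr_const; apply: ler_sum => k _.
  by case: (NCP k).
- move=> x FPhi; apply: contrapT => nC; apply: FPhi; apply: eq_bigr => k _.
  congr (_ * (nat_of_bool _)%:R); apply: asbool_equiv_eq.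
  have := pselect (A k x); have := pselect ((NC k).2 x).
  have : ~ symdiff (A k) (NC k).2 x by move=> h'; apply: nC; exists k => /=.
  rewrite /symdiff /=; tauto.
Qed.

(* Averaging over the p_n floors of a tower selects a floor on which [Phi] is at
   least as good an approximation as on the whole tower; equivariance of [F]
   carries its value to the other floors. *)

Lemma tower_coherence (e : R) : 0 < e -> exists N, forall n, (N <= n)%N ->
  exists c : vertex B n -> R[i], exists C, [/\ measurable C, P C <= e &
    forall x, F x <> lam ^- (s n x) * c (tau n x) -> C x].
Proof.
move=> e0; have [N [Phi [C [dPhi mC PC FC]]]] := quantized_approximation e0.
have lam0 k : lam ^+ k != 0 by rewrite expf_neq0// (prim_root_neq0 lamP).
exists N => n Nn.
(* [Phi] is constant on each floor because n >= N; an empty floor receives the value 0. *)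
pose phi (t : vertex B n) k : R[i] :=
  if pselect (exists x, atom t k x) is left ex then Phi (projT1 (cid ex)) else 0.
have phiP (t : vertex B n) k x : atom t k x -> Phi x = phi t k.
  rewrite /phi; case: pselect => [ex [tx sx]|nex ax]; last by case: nex; exists x.
  case: cid => y /= [ty sy]; apply: dPhi => i iN.
  apply: (@suffix_count_eq _ _ tB 0 n); rewrite ?tx ?sx//.
  exact: leq_trans iN Nn.
have mF Y : measurable ([set x | Y (F x)] : set (borel X)).
  exact: (@measurable_indic_sum _ (borel X) _ A (fun k => lam ^- k) b Y mA).
have p0 : (0 < p n)%N by exact: qprod_gt0.
pose ks t := [arg min_(k < Ordinal p0) P (atom t k `&` [set x | F x <> phi t k])]%O.
(* Undoing the factor [lam ^- (ks t)] of the best floor gives one constant for the whole tower. *)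
pose c t := lam ^+ (ks t) * phi t (ks t).
pose D t k := atom t k `&` [set x | F x <> lam ^- k * c t].
have mD t k : measurable (D t k).
  apply: measurableI; first exact: measurable_atom.
  exact: (mF (fun y => y <> lam ^- k * c t)).
have TD t k : (k.+1 < p n)%N -> T @^-1` (D t k) = D t k.+1.
  move=> kp; rewrite /D preimage_setI (atom_preimage tB pB)//; congr (_ `&` _).
  apply/seteqP; split => x /=; rewrite FT => h h'; apply: h.
    by rewrite h' exprS invfM !mulrA divff ?mul1r//; exact: (lam0 1%N).
  by apply: (mulfI (lam0 1%N)); rewrite expr1 h' exprS invfM !mulrA divff ?mul1r//; exact: (lam0 1%N).
have PD t (k : 'I_(p n)) : P (D t k) <= P (C `&` atom t k).
  rewrite (tower_const muT (mD t) (TD t) (ltn_ord k) (ltn_ord (ks t))).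
  have -> : D t (ks t) = atom t (ks t) `&` [set x | F x <> phi t (ks t)].
    by rewrite /D /c mulrA mulVf// mul1r.
  apply: (@le_trans _ _ (P (atom t k `&` [set x | F x <> phi t k]))).
    by rewrite /ks; case: arg_minP => // i _; exact.
  apply: pr_le.
  - apply: measurableI; first exact: measurable_atom.
    exact: (mF (fun y => y <> phi t k)).
  - by apply: measurableI => //; exact: measurable_atom.
  - by move=> x [ax /= Fx]; split => //; apply: FC; rewrite (phiP _ _ _ ax).
pose E : set (borel X) := [set x | F x <> lam ^- (s n x) * c (tau n x)].
have ED t k : E `&` atom t k = D t k.
  apply/seteqP; split => x /=; first by move=> [Ex [tx sx]]; split => //=; rewrite -tx -sx.
  by move=> [[tx sx] Dx]; split => //; rewrite /E /= tx sx.
have mE : measurable E.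
  by apply: (measurable_of_fibers (h := tower_coord n)) => tk; rewrite tower_coordE ED.
exists c, E; split => //.
apply: le_trans PC; rewrite (pr_atom_sum n mE) (pr_atom_sum n mC).
by apply: ler_sum => tk _; rewrite ED.
Qed.

End Coherence.

(** * Consequences of being an eigenvalue *)

Section PhaseConcentration.
Context (R : realType).
Implicit Types (w : R[i]).

Lemma Re_le_normc w : `|complex.Re w| <= normc w.
Proof.
by case: w => u v; rewrite /normc /= -sqrtr_sqr ler_wsqrtr// lerDl sqr_ge0.
Qed.

Lemma Re_sum (J : Type) (r : seq J) (Q : pred J) (f : J -> R[i]) :
  complex.Re (\sum_(j <- r | Q j) f j) = \sum_(j <- r | Q j) complex.Re (f j).
Proof.
by apply: (big_morph (@complex.Re R)) => // -[? ?] [? ?].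
Qed.

(** The upper bound is the triangle inequality. For the lower one, divide the sum over the class of
    t by z(t), of modulus 1, and take real parts: good terms contribute 1, bad ones at least -1, so
    each bad index costs at most 2. *)
Lemma phase_concentration (V : finType) Q (v : 'I_Q -> V) (w : 'I_Q -> R[i])
    (good : pred 'I_Q) (z : V -> R[i]) :
  (forall i, normc (w i) = 1) -> (forall i, good i -> w i = z (v i)) ->
  Q%:R - 2 * #|[pred i | ~~ good i]|%:R <=
    \sum_t normc (\sum_(i | v i == t) w i) <= Q%:R.
Proof.
move=> w1 wz; apply/andP; split; last first.
  rewrite -[leRHS]mulr1 mulr_natl -[X in _ *+ X]card_ord -sumr_const.
  rewrite [leRHS](partition_big v xpredT)//=; apply: ler_sum => t _.
  by apply: le_trans (normc_sum _ _ _) _; apply: ler_sum => i _; rewrite w1.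
have -> : Q%:R - 2 * #|[pred i | ~~ good i]|%:R =
    \sum_(i < Q) (1 - 2 * (~~ good i)%:R) :> R.
  rewrite sumrB sumr_const card_ord -mulr_sumr; congr (_ - 2 * _).
  by rewrite -natr_sum -sum1_card big_mkcond/=.
rewrite (partition_big v xpredT)//=; apply: ler_sum => t _.
(* Without a good index in the class, the modulus of z(t) is unknown, but the bound to prove is
   nonpositive. *)
have [[i0 vi0 gi0]|nog] := pselect (exists2 i, v i = t & good i); last first.
  apply: le_trans (normc_ge0 _); apply: sumr_le0 => i /eqP vi.
  by case: (boolP (good i)) => [gi|_]; [case: nog; exists i|rewrite mulr1; lra].
have z1 : normc (z t) = 1 by rewrite -vi0 -wz// w1.
have -> : normc (\sum_(i | v i == t) w i) = normc (\sum_(i | v i == t) w i / z t).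
  by rewrite -mulr_suml normcM normcV z1 invr1 mulr1.
apply: le_trans (le_trans (ler_norm _) (Re_le_normc _)); rewrite Re_sum.
apply: ler_sum => i /eqP vi; case: (boolP (good i)) => gi.
  rewrite mulr0 subr0 (wz _ gi) vi divff//; apply/eqP => z0.
  by move: z1; rewrite z0 normc0 => /esym/eqP; rewrite oner_eq0.
have := Re_le_normc (w i / z t); rewrite normcM normcV z1 w1 invr1 mulr1 ler_norml.
by move=> /andP[h _]; rewrite mulr1; lra.
Qed.

End PhaseConcentration.

Section SuffixSums.
Context (R : realType) (B : bratteli) (q : nat -> nat) (tB : toeplitz_type B q).
Local Notation X := (path_space B).
Implicit Types (x : X).

Lemma suffix_set_sum m n (t1 : vertex B m) (t2 : vertex B n) (f : nat -> R[i]) :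
  \sum_(k \in suffix_set t1 t2) f k =
  \sum_(k < qprod q m n | `[< suffix_set t1 t2 k >]) f k.
Proof.
rewrite -(big_mkord (fun k => `[< suffix_set t1 t2 k >])) [RHS]bigfs ?iota_uniq//.
  by apply: eq_fsbigl; apply/seteqP; split => k /= => [?|/asboolP//]; exact/asboolP.
move=> k /asboolP[x [_ _ <-]]; rewrite mem_index_iota/=.
by rewrite (suffix_count_lt tB).
Qed.

(** For m < n the suffix count and tau_n determine the edge [x m], hence its source tau_m(x): each
    suffix belongs to exactly one set. *)
Lemma suffix_setE m n (t1 : vertex B m) x : (m < n)%N ->
  `[< suffix_set t1 (tau n x) (suffix_count m n x) >] = (tau m x == t1).
Proof.
move=> mn; apply/asboolP/eqP => [[y [yt1 yt2 ys]]|<-]; last by exists x.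
rewrite -yt1 /tau; congr src.
by apply/esym; apply: (suffix_count_eq tB yt2 ys); rewrite leqnn.
Qed.

End SuffixSums.

Section EigenvalueNecessary.
Context (R : realType) (B : bratteli) (q : nat -> nat) (tB : toeplitz_type B q)
  (pB : properly_ordered B) (cT : continuous (vershik B))
  (mu : probability (borel (path_space B)) R)
  (muT : forall A : set (borel (path_space B)), measurable A ->
    mu (vershik B @^-1` A) = mu A).
Local Notation X := (path_space B).
Local Notation T := (vershik B).
Local Notation P A := (fine (mu A)).
Local Notation s n x := (suffix_count 0 n x).
Local Notation p n := (qprod q 0 n).
Context (b : nat) (lam : R[i]) (lamP : b.-primitive_root lam).
Context (A : nat -> set (borel X)) (mA : forall k, measurable (A k)).
Local Notation F := (phase_sum b lam A).
Context (FT : forall x, F (T x) = lam * F x).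
Context (Z : set (borel X)) (mZ : measurable Z) (Z0 : mu Z = 0%E)
  (FZ : forall x, F x = 0 -> Z x).

Let q_pos := q_gt0 tB.
Let lam0 k : lam ^+ k != 0.
Proof. by rewrite expf_neq0// (prim_root_neq0 lamP). Qed.

(** At a point where the approximations of levels m and n both hold, comparing them and using s_n =
    s_m + p_m k expresses lambda^(-p_m k) as a function of tau_m alone, once tau_n is fixed. Then
    [phase_concentration] applies to the slices of the tower by k. *)
Lemma suffix_sums_concentrate (t2 : forall n, vertex B n) (delta : R) :
  0 < delta ->
  (forall n, (0 < n)%N -> delta <= P [set x | tau n x = t2 n]) ->
  forall eps : R, 0 < eps ->
  exists N : nat, forall m n : nat, (N < m)%N -> (m < n)%N ->
    `| \sum_(t1 : vertex B m)
         normc (\sum_(k \in suffix_set t1 (t2 n)) lam ^- (p m * k))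
           / (qprod q m n)%:R - 1 | < eps.
Proof.
move=> d0 dt2 eps e0.
(* The two bad sets together have measure at most eps delta / 4. A slice has measure at least delta
   / Q, so at most a fraction eps / 4 of the slices is bad, which costs at most eps / 2. *)
have e'0 : 0 < eps * delta / 8 by rewrite divr_gt0// mulr_gt0.
have [N coh] := tower_coherence tB pB muT lamP mA FT e'0.
exists N => m n Nm mn.
have [cm [Cm [mCm PCm FCm]]] := coh m (ltnW Nm).
have [cn [Cn [mCn PCn FCn]]] := coh n (ltnW (ltn_trans Nm mn)).
pose Bd : set (borel X) := (Cm `|` Cn) `|` Z.
have mBd : measurable Bd by apply: measurableU => //; exact: measurableU.
have PBd : P Bd <= eps * delta / 4.
  apply: le_trans (prU_le mu (measurableU _ _ mCm mCn) mZ) _.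
  have := prU_le mu mCm mCn; rewrite Z0/=; lra.
have m_le_n : (m <= n)%N by exact: ltnW.
pose Q := qprod q m n.
have Q0 : 0 < Q%:R :> R by rewrite ltr0n qprod_gt0.
pose Y : set (borel X) := [set x | tau n x = t2 n].
have mY : measurable Y by exact: measurable_tau.
pose W (k : nat) : set (borel X) := Y `&` [set x | suffix_count m n x = k].
have mW k : measurable (W k).
  by apply: measurableI => //; exact: measurable_suffix.
have dY : delta <= P Y by apply: dt2; exact: leq_ltn_trans mn.
have PW (k : 'I_Q) : P (W k) = P Y / Q%:R.
  by rewrite -(suffix_pr tB pB muT (t2 n) m_le_n (ltn_ord k)) mulfK// gt_eqF.
pose good (k : 'I_Q) := `[< exists x, W k x /\ ~ Bd x >].
(* Each slice gets a representative, chosen outside the bad set whenever possible; a bad slice lies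
   entirely in the bad set. *)
have exW (k : 'I_Q) : exists x, W k x /\ (good k -> ~ Bd x).
  have [/asboolP[x [Wx Bx]]|gk] := boolP (good k); first by exists x.
  have /set0P[x Wx] : W k != set0.
    apply/eqP => W0; have := PW k; rewrite W0 pr0 => /eqP; rewrite eq_sym mulf_eq0.
    by rewrite invr_eq0 (gt_eqF Q0) orbF gt_eqF// (lt_le_trans d0).
  by exists x.
have [xs xsP] := choice exW.
have taun k : tau n (xs k) = t2 n by case: (xsP k) => -[].
have sufk k : suffix_count m n (xs k) = k by case: (xsP k) => -[].
have nbad : #|[pred k | ~~ good k]|%:R * (P Y / Q%:R) <= P Bd.
  apply: (@le_trans _ _ (P (Bd `&` Y))); last first.
    by apply: (pr_le mu (measurableI _ _ mBd mY) mBd) => x [].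
  rewrite (pr_suffix_sum tB mu m n (measurableI _ _ mBd mY)) mulr_natl -sumr_const.
  rewrite big_mkcond/=; apply: ler_sum => k _; rewrite inE.
  case: ifPn => gk; last exact: pr_ge0.
  rewrite -(PW k); apply: pr_le => //.
    by apply: measurableI; [exact: measurableI|exact: measurable_suffix].
  move=> x [Yx sx]; split => //; split => //; apply: contrapT => Bx.
  by move/asboolP : gk; apply; exists x.
have goodE (k : 'I_Q) : good k -> lam ^- (p m * k) = cm (tau m (xs k)) / cn (t2 n).
  have [_ /[apply]] := xsP k; set x := xs k => Bx.
  have Fm : F x = lam ^- (s m x) * cm (tau m x).
    by apply: contrapT => h; apply: Bx; left; left; exact: FCm.
  have Fn : F x = lam ^- (s n x) * cn (t2 n).
    by apply: contrapT => h; apply: Bx; left; right; apply: FCn; rewrite taun.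
  have F0 : F x <> 0 by move=> h; apply: Bx; right; exact: FZ.
  have cn0 : cn (t2 n) != 0.
    by apply/eqP => c0; apply: F0; rewrite Fn c0 mulr0.
  apply: (mulIf cn0); rewrite divfK//.
  apply: (@mulfI _ (lam ^- (s m x))); first by rewrite invr_neq0.
  rewrite -Fm Fn (suffix_count_cat tB x (leq0n m) m_le_n) sufk exprD invfM mulrA.
  by rewrite [_^-1 * _^-1]mulrC.
have sumE (t1 : vertex B m) : \sum_(k \in suffix_set t1 (t2 n)) lam ^- (p m * k) =
    \sum_(k < Q | tau m (xs k) == t1) lam ^- (p m * k).
  rewrite (suffix_set_sum tB); apply: eq_bigl => k.
  by rewrite -{1}(taun k) -{1}(sufk k) (suffix_setE tB).
rewrite -mulr_suml (eq_bigr _ (fun t1 _ => congr1 _ (sumE t1))).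
have w1 (k : 'I_Q) : normc (lam ^- (p m * k)) = 1.
  by rewrite normcV normcX (normc_prim_root lamP) expr1n invr1.
have := @phase_concentration R _ Q (fun k => tau m (xs k))
  (fun k => lam ^- (p m * k)) good (fun t => cm t / cn (t2 n)) w1 goodE.
move=> /andP[lo hi].
have bQ : #|[pred k | ~~ good k]|%:R / Q%:R <= eps / 4.
  have : #|[pred k | ~~ good k]|%:R / Q%:R * delta <= eps / 4 * delta.
    apply: (@le_trans _ _ (P Bd)); last by move: PBd; lra.
    apply: le_trans nbad; rewrite mulrAC -mulrA ler_wpM2l//.
    by rewrite ler_wpM2r// invr_ge0 ltW.
  by rewrite ler_pM2r.
rewrite ltr_norml; apply/andP; split; last first.
  by rewrite ltrBlDr; apply: (@le_lt_trans _ _ 1); [rewrite ler_pdivrMr// mul1r|lra].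
rewrite ltrBrDr; apply: (@lt_le_trans _ _ ((Q%:R - 2 * #|[pred k | ~~ good k]|%:R) / Q%:R)).
  by rewrite mulrBl divff ?gt_eqF// -mulrA; lra.
by rewrite ler_wpM2r// invr_ge0 ltW.
Qed.

(** Follow a point that avoids the bad set at the times j p_m, for j up to #V_m. Its s_m does not
    change, so c(tau_m) runs through a nonzero constant times lambda^(j p_m). If the order of
    lambda^(p_m) exceeded #V_m, these #V_m + 1 values would be distinct, yet tau_m takes only #V_m
    values. *)
Lemma residual_order_le_card :
  exists N, forall m, (N <= m)%N -> (b %/ gcdn b (p m) <= #|vertex B m|)%N.
Proof.
(* If #V_m is below the order, then #V_m + 1 <= b, so the #V_m + 1 preimages of a set of measure at
   most 1 / (b + 1) cannot cover the space. *)
have e0 : 0 < b.+1%:R^-1 :> R by rewrite invr_gt0 ltr0n.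
have [N coh] := tower_coherence tB pB muT lamP mA FT e0.
exists N => m Nm; have [c [C [mC PC FC]]] := coh m Nm.
rewrite leqNgt; apply/negP => Vb; set V := #|vertex B m| in Vb.
have lampP : (b %/ gcdn b (p m)).-primitive_root (lam ^+ p m).
  by rewrite gcdnC; exact: exp_prim_root.
pose Bd : set (borel X) := C `|` Z.
have mBd : measurable Bd by exact: measurableU.
have PBd : P Bd <= b.+1%:R^-1.
  by apply: le_trans (prU_le mu mC mZ) _; rewrite Z0/= addr0.
pose D j : set (borel X) := iter (j * p m) T @^-1` Bd.
have mD j : measurable (D j) by exact: measurable_iter.
have [mU PU] := pr_bigcup_le mu V.+1 mD.
have {}PU : P (\bigcup_(j in [set j | (j < V.+1)%N]) D j) < 1.
  apply: le_lt_trans PU _; apply: (@le_lt_trans _ _ (V.+1%:R / b.+1%:R)).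
    rewrite mulr_natl -[X in _ *+ X]card_ord -sumr_const; apply: ler_sum => j _.
    by rewrite /D mu_iter.
  rewrite ltr_pdivrMr ?ltr0n// mul1r ltr_nat ltnS.
  exact: leq_trans Vb (leq_div _ _).
have [x Dx] : exists x, forall j, (j < V.+1)%N -> ~ D j x.
  apply: contrapT => h; move: PU; rewrite (_ : \bigcup_(_ in _) _ = setT) ?prT ?ltxx//.
  apply/seteqP; split => x // _; apply: contrapT => nx; apply: h; exists x => j jV Dx.
  by apply: nx; exists j.
have FTi j y : F (iter j T y) = lam ^+ j * F y.
  by elim: j => [|j IH] /=; rewrite ?mul1r// FT IH exprS mulrA.
have cE (j : 'I_V.+1) : c (tau m (iter (j * p m) T x)) =
    lam ^+ (s m x) * F x * (lam ^+ p m) ^+ j.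
  have nB := Dx j (ltn_ord j).
  have : F (iter (j * p m) T x) =
      lam ^- (s m (iter (j * p m) T x)) * c (tau m (iter (j * p m) T x)).
    by apply: contrapT => h; apply: nB; left; exact: FC.
  rewrite (suffix_iter_height tB pB) FTi => E.
  apply: (@mulfI _ (lam ^- s m x)); first by rewrite invr_eq0 lam0.
  by rewrite -E 2!mulrA mulVf ?lam0// mul1r mulrC -exprM mulnC.
have F0 : F x != 0.
  by apply/eqP => F0; apply: (Dx 0%N (ltn0Sn _)); right; exact: FZ.
have inj : injective (fun j : 'I_V.+1 => tau m (iter (j * p m) T x)).
  move=> j j' /(congr1 c); rewrite !cE => /mulfI h.
  have /eqP := h (ltac:(by rewrite mulf_neq0)).
  rewrite (eq_prim_root_expr lampP) !modn_small; first by move/eqP/val_inj.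
    by apply: leq_trans Vb; exact: ltn_ord.
  by apply: leq_trans Vb; exact: ltn_ord.
have := leq_card _ inj; rewrite card_ord.
by rewrite ltnn.
Qed.

End EigenvalueNecessary.

(** * Continuous eigenvalues *)

Section ContinuousEigenvalues.
Context (R : realType) (B : bratteli) (q : nat -> nat) (tB : toeplitz_type B q)
  (pB : properly_ordered B).
Local Notation X := (path_space B).
Local Notation T := (vershik B).
Local Notation s n x := (suffix_count 0 n x).
Local Notation p n := (qprod q 0 n).
Context (b : nat) (lam : R[i]) (lamP : b.-primitive_root lam).

Let lam0 : lam != 0 := prim_root_neq0 lamP.

(** The eigenfunction is lambda^(-s_n): T lowers s_n by one modulo p_n, and lambda^(p_n) = 1. *)
Lemma dvd_continuous_eigenvalue n : (b %| p n)%N -> continuous_eigenvalue T lam.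
Proof.
move=> bp; exists (fun x => lam ^- (s n x)); split.
- move=> x; have oU : open [set y : X | s n y = s n x].
    exact: determined_open (@suffix_determined B q tB 0 n (s n x)).
  have nU : nbhs x [set y : X | s n y = s n x] by apply: open_nbhs_nbhs; split.
  apply: (@cvg_near_cst X R[i]^o _ _ (nbhs x)).
  by apply: filterS nU => y /= ->.
- exists point; apply/eqP; rewrite invr_eq0 expf_eq0 (negbTE lam0) andbF//.
- move=> x; have [s0|s0] := posnP (s n x).
    rewrite (suffix_vershik0 tB pB s0) s0 expr0 invr1 mulr1.
    apply: invr_inj; rewrite invrK; apply: (mulfI lam0).
    rewrite -exprS prednK ?(qprod_gt0 (q_gt0 tB))// divff//.
    by apply/eqP; rewrite -(prim_order_dvd lamP).
  by rewrite (suffix_vershik tB pB s0) exprS invfM mulrA divff// mul1r.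
Qed.

Lemma root_gap : exists2 kappa : R, 0 < kappa &
  forall j, lam ^+ j != 1 -> kappa <= normc (1 - lam ^+ j).
Proof.
have b0 := prim_order_gt0 lamP.
(* Powers of [lam] take finitely many values; the default 1 serves when all of them equal 1. *)
exists (\big[Order.min/1]_(j < b | lam ^+ j != 1) normc (1 - lam ^+ j)).
  apply: lt_bigmin => // j j1; rewrite lt_def normc_ge0 andbT.
  by apply: contra j1 => /eqP/eq0_normc/eqP; rewrite subr_eq0 eq_sym.
move=> j; rewrite -(prim_expr_mod lamP) => j1.
exact: (@bigmin_le_cond _ _ _ 1 (Ordinal (ltn_pmod j b0))
  (fun k : 'I_b => lam ^+ k != 1) (fun k : 'I_b => normc (1 - lam ^+ k)) j1).
Qed.

(** After p_n steps s_n is 0 again, so the first n edges are maximal. By (H4) the maximal edges one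
    level up share their source, which fixes the end of edge i and thus edge i. This uses edge i +
    1, whence [i.+1 < n]. *)
Lemma max_path_return n (x : X) :
  (forall n (e f : edge B n.+1), max_edge e -> max_edge f -> src e = src f) ->
  max_path x -> forall i, (i.+1 < n)%N -> iter (p n) T x i = x i.
Proof.
move=> H4 mx i ni.
have s0 : s n x = 0%N by apply/(suffix_count0_max tB n x) => j _; exact: mx.
have my : forall j, (j < n)%N -> max_edge (iter (p n) T x j).
  apply/(suffix_count0_max tB n _).
  by rewrite -[p n]mul1n (suffix_iter_height tB pB).
apply: (rank_inj).
  by rewrite !path_edgeP; apply: H4; [exact: my|exact: mx].
by have := my i (ltnW ni); have := mx i; rewrite !max_edgeE => /eqP -> /eqP ->.
Qed.

(** By continuity at the maximal path, lambda^(p_n) f(x_max) is close to f(x_max) for large n; as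
    f(x_max) is not 0, [root_gap] forces lambda^(p_n) = 1. *)
Lemma continuous_eigenvalue_dvd :
  (forall n (e f : edge B n.+1), max_edge e -> max_edge f -> src e = src f) ->
  (forall A : set X, closed A -> A !=set0 -> T @` A `<=` A -> A = setT) ->
  continuous_eigenvalue T lam -> exists N, forall n, (N <= n)%N -> (b %| p n)%N.
Proof.
move=> H4 minT [f [cf [x0 fx0] fT]].
have [[xm [mx _]] _] := pB.
have fxm : f xm <> 0.
  (* The zero set of f is closed and T-invariant, so by minimality it would be the whole space. *)
  move=> f0; apply: fx0; suff h : f @^-1` [set 0] = setT.
    by have : (f @^-1` [set 0]) x0 by rewrite h.
  apply: minT.
  - apply: (@closed_comp _ R[i]^o f [set 0]); first by move=> x _; exact: cf.
    by apply: accessible_closed_set1; exact/hausdorff_accessible/norm_hausdorff.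
  - by exists xm.
  - by move=> _ [x fx <-]; rewrite /preimage/= fT (fx : f x = 0) mulr0.
have [kappa k0 kP] := root_gap.
have nf : 0 < normc (f xm).
  by rewrite lt_def normc_ge0 andbT; apply/eqP => /eq0_normc.
have e0 : 0 < (kappa * normc (f xm))%:C%C :> R[i] by rewrite ltcR mulr_gt0.
have := @cvgr_dist_lt _ R[i]^o X (nbhs xm) (nbhs_filter xm) f (f xm) (cf xm) _ e0.
rewrite nbhsE => -[U [oU Uxm] Uf].
have [N NU] := open_cylinder oU Uxm.
exists N.+1 => n Nn.
have /Uf : U (iter (p n) T xm).
  by apply: NU => i /= iN; apply: max_path_return => //; exact: leq_trans Nn.
have -> : f (iter (p n) T xm) = lam ^+ p n * f xm.
  by elim: (p n) => [|j IH] /=; rewrite ?mul1r// fT IH exprS mulrA.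
have normE (z : R[i]) : `|z| = (normc z)%:C%C by case: z => u v; rewrite normc_def.
move=> h; have {h} : `|f xm - lam ^+ p n * f xm : R[i]| < (kappa * normc (f xm))%:C%C := h.
rewrite normE ltcR -[X in X - _]mul1r -mulrBl normcM ltr_pM2r// => lt.
rewrite (prim_order_dvd lamP); apply: contraLR lt => /kP.
by rewrite -leNgt.
Qed.

End ContinuousEigenvalues.

(** * Construction of an eigenfunction *)

(* Replaces a diagonal extraction: all bounded sequences get a limit at once. *)

Lemma nat_ultralimit (R : realType) : exists U : set_system nat,
  [/\ ProperFilter U, (forall Q : set nat, (\forall n \near \oo, Q n) -> U Q) &
      forall u : nat -> R, (forall n, 0 <= u n <= 1) -> exists l : R, u @ U --> l].
Proof.
have [U [UU oU]] := @ultraFilterLemma nat \oo _.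
exists U; split => // [|u u01]; first exact: ultra_proper.
(* The image of an ultrafilter is an ultrafilter, and it converges because [0, 1] is compact. *)
have uU : UltraFilter (u @ U).
  have UP := @ultra_proper _ _ UU.
  split; first exact: fmap_proper_filter.
  move=> G GG uG; apply/seteqP; split => // A GA.
  have [//|UCA] := in_ultra_setVsetC (u @^-1` A) UU.
  have /filter_ex[x [Ax //]] : G (A `&` ~` A).
  by apply: filterI => //; apply: uG.
have := @segment_compact R 0 1; rewrite compact_ultra => /(_ (u @ U) uU).
case; last by move=> l [_ ul]; exists l.
have -> : (u @ U) `[0, 1]%classic = U setT; last exact: filterT.
by congr (U _); apply/seteqP; split => n //= _; rewrite in_itv/=.
Qed.

Section DominatedContent.
Context (R : realType) (B : bratteli) (mu : probability (borel (path_space B)) R).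
Local Notation X := (path_space B).
Local Notation P A := (fine (mu A)).
Context (nu : set (borel X) -> R) (nu_ge0 : forall A, 0 <= nu A)
  (nu_add : forall A C, measurable A -> measurable C -> A `&` C = set0 ->
    nu (A `|` C) = nu A + nu C)
  (nu_le : forall A, measurable A -> nu A <= P A).

Definition content_EFin : set (borel X) -> \bar R := fun A => (nu A)%:E.
Local Notation nuE := content_EFin.

Let nuE0 : nuE set0 = 0%E.
Proof.
congr (_%:E); have := nu_add measurable0 measurable0 (setIid _); rewrite setUid; lra.
Qed.

Let nuE_ge0 A : (0 <= nuE A)%E.
Proof. by rewrite lee_fin. Qed.

(** Additivity reduces the claim to the remainders of the union, whose [nu] is at most their
    mu-measure, which tends to 0. *)
Let nuE_sigma : semi_sigma_additive nuE.
Proof.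
move=> F mF tF mUF.
pose G n : set (borel X) := \bigcup_(i in [set i | (i < n)%N]) F i.
have GS n : G n.+1 = G n `|` F n.
  apply/seteqP; split => x /=.
    move=> [i /=]; rewrite ltnS leq_eqVlt => /orP[/eqP ->|]; first by right.
    by move=> ni Fx; left; exists i.
  by move=> [[i /= ni Fx]|Fx]; [exists i => //=; exact: leqW|exists n => /=].
have mG n : measurable (G n) by apply: bigcup_measurable.
have G0 : G 0%N = set0 by apply/seteqP; split => // x -[].
have sumG n : (\sum_(0 <= i < n) nuE (F i))%E = (nu (G n))%:E.
  elim: n => [|n IH]; first by rewrite big_geq// G0 -nuE0.
  rewrite big_nat_recr//= IH GS nu_add//.
  apply/seteqP; split => // x [[i /= ni Fix] Fx].
  by have := tF i n I I (ex_intro _ x (conj Fix Fx)); lia.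
have GF : \bigcup_n G n = \bigcup_n F n.
  apply/seteqP; split => x; first by move=> [n _ [i _ Fx]]; exists i.
  by move=> [n _ Fx]; exists n.+1 => //; exists n => /=.
have ndG : nondecreasing_seq G.
  move=> m n mn; apply/subsetPset => x [i /= im Fx]; exists i => //=.
  exact: leq_trans mn.
rewrite (_ : (fun n => _) = EFin \o (fun n => nu (G n))); last by apply/funext.
apply: cvg_EFin; first by near=> n.
apply/cvgrPdist_le => e e0.
have [N hN] := pr_exhaust mu mG ndG e0.
exists N => // n /= Nn.
have GnF : G n `<=` \bigcup_i F i by rewrite -GF => x Gx; exists n.
have mD : measurable (\bigcup_i F i `\` G n) by exact: measurableD.
have := nu_add (mG n) mD (_ : G n `&` _ = set0).
rewrite setDUK// => /(_ (ltac:(by rewrite setDE setICA setICr setI0))) ->.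
rewrite /= addrAC subrr add0r ger0_norm//.
apply: le_trans (nu_le mD) _; apply: le_trans hN; rewrite GF.
apply: pr_le => //; first exact: measurableD.
by apply: setDS => x Gx; have /subsetPset := ndG _ _ Nn; apply.
Unshelve. all: by end_near.
Qed.

HB.instance Definition _ := isMeasure.Build _ _ _ nuE nuE0 nuE_ge0 nuE_sigma.

Let nuE_fin : fin_num_fun nuE.
Proof. by move=> A mA. Qed.

HB.instance Definition _ := Measure_isFinite.Build _ _ _ nuE nuE_fin.

Lemma dominated_density : exists h : X -> R,
  [/\ forall x, 0 <= h x,
      mu.-integrable [set: borel X] (fun x : borel X => (h x)%:E) &
      forall A, measurable A -> (\int[mu]_(x in A) (h x)%:E = (nu A)%:E)%E].
Proof.
have dom : nuE `<< mu.
  move=> N N0 A mA AN; apply/eqP; rewrite eqe eq_le nu_ge0 andbT.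
  by apply: le_trans (nu_le mA) _; rewrite N0.
have [f [f0 ffin fint fE]] := radon_nikodym_sigma_finite dom.
have fK x : (fine (f x))%:E = f x by rewrite fineK.
exists (fun x => fine (f x)); split.
- by move=> x; exact: fine_ge0.
- by rewrite (_ : (fun x => _) = f)//; apply/funext.
- by move=> A mA; under eq_integral do rewrite fK; rewrite -fE.
Qed.

End DominatedContent.

Section EigenvalueOfDensities.
Context (R : realType) (X : ptopologicalType) (T : X -> X)
  (mu : probability (borel X) R) (b : nat) (lam : R[i])
  (lamP : b.-primitive_root lam).

Lemma Re_realM (z : R[i]) (u : R) : complex.Re (z * u%:C%C) = complex.Re z * u.
Proof. by case: z => ? ?; rewrite /= mulr0 subr0. Qed.

Lemma Im_realM (z : R[i]) (u : R) : complex.Im (z * u%:C%C) = complex.Im z * u.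
Proof. by case: z => ? ?; rewrite /= mulr0 add0r. Qed.

Lemma Im_sum (J : Type) (r : seq J) (Q : pred J) (f : J -> R[i]) :
  complex.Im (\sum_(j <- r | Q j) f j) = \sum_(j <- r | Q j) complex.Im (f j).
Proof.
by apply: (big_morph (@complex.Im R)) => // -[? ?] [? ?].
Qed.

(** The shift relation gives g(T x) = lambda g(x) almost everywhere. The densities are only assumed
    measurable, so g is replaced by its phase, which is bounded by b, hence square integrable, and
    vanishes only where g does. *)
Lemma eigenvalue_of_densities (h : nat -> X -> R) :
  (forall r, measurable_fun [set: borel X] (h r : borel X -> R)) ->
  (forall r, {ae mu, forall x : borel X, h r (T x) = h r.+1 x}) ->
  (forall x, h b x = h 0%N x) ->
  ~ {ae mu, forall x : borel X, \sum_(r < b) lam ^- r * ((h r x)%:C)%C = 0} ->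
  eigenvalue_for T mu lam.
Proof.
move=> mh hT hb; pose g (x : borel X) := \sum_(r < b) lam ^- r * ((h r x)%:C)%C.
rewrite -/g => gN0.
have mg : cmeasurable g.
  split.
    rewrite (_ : (fun _ => _) = fun x => \sum_(r < b) complex.Re (lam ^- r) * h r x).
      by apply: measurable_sum => r; apply: measurable_funM.
    by apply/funext => x; rewrite Re_sum; apply: eq_bigr => r _; rewrite Re_realM.
  rewrite (_ : (fun _ => _) = fun x => \sum_(r < b) complex.Im (lam ^- r) * h r x).
    by apply: measurable_sum => r; apply: measurable_funM.
  by apply/funext => x; rewrite Im_sum; apply: eq_bigr => r _; rewrite Im_realM.
pose A k : set (borel X) := [set x | fund_domain lam (lam ^+ k * g x)].
have mA k : measurable (A k) by apply: measurable_fund_domain; exact: cmeasurable_scale.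
have mF (Y : set R[i]) : measurable [set x | Y (phase_sum b lam A x)].
  exact: (@measurable_indic_sum _ (borel X) _ A (fun k => lam ^- k) b Y mA).
exists (phase_sum b lam A); split.
- split.
  + move=> _ Y mY; rewrite setTI; exact: (mF (fun z => Y (complex.Re z))).
  + move=> _ Y mY; rewrite setTI; exact: (mF (fun z => Y (complex.Im z))).
  + apply: (@le_lt_trans _ _ (\int[mu]_(x in [set: borel X]) ((b%:R ^+ 2)%:E : \bar R))%E).
      apply: ge0_le_integral => //.
      * by move=> x _; rewrite lee_fin exprn_ge0// normc_ge0.
      * move=> _ Y mY; rewrite setTI.
        rewrite (_ : _ @^-1` _ = [set x | [set z | Y ((normc z ^+ 2)%:E)] (phase_sum b lam A x)]).
          exact: mF.
        by [].
      * move=> x _; rewrite lee_fin ler_pXn2r ?nnegrE ?normc_ge0//.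
        rewrite -[leRHS]mulr1 mulr_natl -[X in _ *+ X]card_ord -sumr_const.
        apply: le_trans (normc_sum _ _ _) _; apply: ler_sum => k _.
        rewrite normcM normcV normcX (normc_prim_root lamP) expr1n invr1 mul1r.
        by case: asboolP => _; rewrite ?normc1 ?normc0.
    rewrite integral_cst//; apply: lte_mul_pinfty => //.
    by rewrite -ge0_fin_numE// fin_num_measure.
- by apply: contra_not gN0; apply: filterS => x; exact: phase_eq0 lamP _.
- have := ae_foralln hT; apply: filterS => x hTx.
  have E y : phase_sum b lam A y =
    phase_sum b lam (fun k z => fund_domain lam (lam ^+ k * z)) (g y) by [].
  rewrite !E -phase_mul//; congr (phase_sum b lam _ _).
  have lam0 := prim_root_neq0 lamP.
  pose u k := lam ^- k * ((h k x)%:C)%C.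
  rewrite [g (T x)](eq_bigr (fun k : 'I_b => lam * u k.+1)); last first.
    by move=> k _; rewrite /u hTx exprS invfM !mulrA divff// mul1r.
  rewrite -mulr_sumr sum_periodic_shift//.
  by rewrite /u (prim_expr_order lamP) expr0 hb.
Qed.

End EigenvalueOfDensities.

Lemma cvg_sum_seq (R : realType) (J : Type) (r : seq J) (F : set_system nat)
    (FF : Filter F) (f : J -> nat -> R) (l : J -> R) :
  (forall j, f j @ F --> l j) ->
  (fun n => \sum_(j <- r) f j n) @ F --> \sum_(j <- r) l j.
Proof.
move=> fl; elim: r => [|j r IH].
  rewrite big_nil (_ : (fun n => _) = cst (0 : R)); first exact: cvg_cst.
  by apply/funext => n; rewrite big_nil.
rewrite big_cons (_ : (fun n => _) = f j \+ (fun n => \sum_(j <- r) f j n)).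
  exact: cvgD.
by apply/funext => n; rewrite big_cons.
Qed.

Section EigenvalueSufficient.
Context (R : realType) (B : bratteli) (q : nat -> nat) (tB : toeplitz_type B q)
  (pB : properly_ordered B) (cT : continuous (vershik B))
  (S : path_space B -> path_space B) (cS : continuous S)
  (TK : cancel (vershik B) S)
  (mu : probability (borel (path_space B)) R)
  (muT : forall A : set (borel (path_space B)), measurable A ->
    mu (vershik B @^-1` A) = mu A).
Local Notation X := (path_space B).
Local Notation T := (vershik B).
Local Notation P A := (fine (mu A)).
Local Notation s n x := (suffix_count 0 n x).
Local Notation p n := (qprod q 0 n).
Context (b : nat) (lam : R[i]) (lamP : b.-primitive_root lam).
Context (t : forall n, vertex B n).
Implicit Types (A C : set (borel X)).

Let q_pos := q_gt0 tB.

Definition residue_set r n : set (borel X) :=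
  [set x | tau n x = t n /\ s n x = r %[mod b]].
Local Notation Y := residue_set.

Lemma measurable_residue_set r n : measurable (Y r n).
Proof.
apply: (@determined_measurable B n.+1) => x y xy [tx sx].
rewrite /residue_set /= -tx -sx /tau xy//; split => //; congr (_ %% _)%N.
by apply/esym/(eq_suffix_count tB) => i /andP[_ ni]; apply/xy/leqW.
Qed.

Lemma residue_set_modb r n : Y (r %% b) n = Y r n.
Proof. by apply/seteqP; split => x; rewrite /residue_set /= modn_mod. Qed.

Lemma residue_set_vershik r n x : (0 < s n x)%N -> Y r n (T x) <-> Y r.+1 n x.
Proof.
move=> s0; rewrite /residue_set /= (tau_vershik tB pB s0).
rewrite [in X in _ <-> X](suffix_vershik tB pB s0).
have E : ((s n (T x)).+1 == r.+1 %[mod b]) = (s n (T x) == r %[mod b])%N.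
  by rewrite -[(s n (T x)).+1]addn1 -[r.+1]addn1 eqn_modDr.
by split=> -[-> /eqP h]; split => //; apply/eqP; rewrite ?E // -E.
Qed.

(** Where s_n > 0, T stays in the tower and lowers the residue by one, so the two sets can differ
    only inside s_n = 0. *)
Lemma residue_set_shift r n A : measurable A ->
  `|P (T @^-1` A `&` Y r.+1 n) - P (A `&` Y r n)| <= (p n)%:R^-1.
Proof.
move=> mA; have mY := measurable_residue_set.
have mAY k : measurable (A `&` Y k n) by exact: measurableI.
have mTA : measurable (T @^-1` A : set (borel X)) by exact: measurable_vershik.
pose Z : set (borel X) := [set x | s n x = 0%N].
have mZ : measurable Z by exact: measurable_suffix.
have PZ : P Z = (p n)%:R^-1.
  apply: (@mulIf _ (p n)%:R); first by rewrite pnatr_eq0 -lt0n qprod_gt0.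
  by rewrite (pr_suffix0 tB pB muT) mulVf// pnatr_eq0 -lt0n qprod_gt0.
have -> : P (A `&` Y r n) = P (T @^-1` A `&` T @^-1` (Y r n)).
  by rewrite -muT// preimage_setI.
have mTY : measurable (T @^-1` (Y r n) : set (borel X)) by exact: measurable_vershik.
have m1 : measurable (T @^-1` A `&` Y r.+1 n : set (borel X)) by exact: measurableI.
have m2 : measurable (T @^-1` A `&` T @^-1` (Y r n) : set (borel X)) by exact: measurableI.
rewrite -PZ ler_norml; apply/andP; split.
  suff : P (T @^-1` A `&` T @^-1` (Y r n)) <= P (T @^-1` A `&` Y r.+1 n) + P Z by lra.
  apply: le_trans (prU_le mu m1 mZ); apply: pr_le => //; first exact: measurableU.
  move=> x [Ax Yx]; have [sx|sx] := posnP (s n x); first by right.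
  by left; split => //; exact/(residue_set_vershik r sx).
suff : P (T @^-1` A `&` Y r.+1 n) <= P (T @^-1` A `&` T @^-1` (Y r n)) + P Z by lra.
apply: le_trans (prU_le mu m2 mZ); apply: pr_le => //; first exact: measurableU.
move=> x [Ax Yx]; have [sx|sx] := posnP (s n x); first by right.
by left; split => //; exact/(residue_set_vershik r sx).
Qed.

(** The base of the tower over [t1], cut by tau_n = t and the residue r, is a union of floors s_n =
    p_m k with k a suffix from [t1] and p_m k = r modulo b. All floors have the same measure, so
    summing over r gives the suffix sum. *)
Lemma residue_fourier m n (t1 : vertex B m) : (m < n)%N ->
  (forall k, (k < qprod q m n)%N -> exists x, tau n x = t n /\ suffix_count m n x = k) ->
  \sum_(r < b) lam ^- r * ((P (atom t1 0 `&` Y r n))%:C)%C =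
  ((P [set x | tau n x = t n] / (p n)%:R)%:C)%C *
    \sum_(k \in suffix_set t1 (t n)) lam ^- (p m * k).
Proof.
move=> mn ex; set c := P _ / _; have b0 := prim_order_gt0 lamP.
have m_le_n := ltnW mn.
have mY := measurable_residue_set.
have atomE (r : 'I_b) (k : 'I_(qprod q m n)) :
    P (atom t1 0 `&` Y r n `&` [set x | suffix_count m n x = k]) =
    (`[< suffix_set t1 (t n) k >] && ((p m * k) %% b == r)%N)%:R * c.
  have kp : (p m * k < p n)%N.
    by rewrite -(qprodM q (leq0n m) m_le_n) ltn_pmul2l ?qprod_gt0.
  have sE (x : X) : s n x = (s m x + p m * suffix_count m n x)%N.
    exact: (suffix_count_cat tB x (leq0n m) m_le_n).
  case: asboolP => [[y [ty1 ty2 sy]]|nS] /=; last first.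
    rewrite mul0r (_ : _ `&` _ = set0) ?pr0//; apply/seteqP; split => // x.
    move=> [[[tx1 _] [tx2 _]] sx]; apply: nS.
    by exists x.
  case: eqP => [kr|kr]; last first.
    rewrite mul0r (_ : _ `&` _ = set0) ?pr0//; apply/seteqP; split => // x.
    move=> [[[_ sx0] [_ sx]] sx']; apply: kr; move: sx.
    by rewrite sE sx0 sx' add0n => ->; rewrite modn_small.
  rewrite mul1r /c -(atom_pr tB pB muT (t n) kp) mulfK; last first.
    by rewrite pnatr_eq0 -lt0n qprod_gt0.
  congr (fine (mu _)); apply/seteqP; split => x.
    by move=> [[[tx1 sx0] [tx2 _]] sx]; split => //; rewrite sE sx0 sx add0n.
  move=> [tx2]; rewrite sE => sx.
  have Q0 : (0 < p m)%N by exact: qprod_gt0.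
  have sm : s m x = 0%N.
    have := congr1 (modn^~ (p m)) sx; rewrite addnC mulnC modnMDl modnMr.
    by rewrite modn_small// (suffix_count_lt tB).
  have sk : suffix_count m n x = k.
    by apply/eqP; rewrite -(eqn_pmul2l Q0) -sx sm add0n.
  split=> //; split; last first.
    by split => //; rewrite sE sm add0n sk kr modn_small.
  split => //; rewrite -ty1 /tau; congr src.
  by apply: (suffix_count_eq tB (m := m) (n := n)); rewrite ?leqnn// ?ty2 ?sy.
under eq_bigr => r _.
  rewrite (pr_suffix_sum tB mu m n (measurableI _ _ (measurable_atom tB t1 0) (mY r n))).
  rewrite rmorph_sum/= mulr_sumr; under eq_bigr => k _ do rewrite atomE rmorphM/=.
  over.
rewrite exchange_big/= (suffix_set_sum tB) mulr_sumr [RHS]big_mkcond/=.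
apply: eq_bigr => k _; case: asboolP => _ /=; last first.
  by apply: big1 => r _; rewrite rmorph0 mul0r mulr0.
rewrite (bigD1 (Ordinal (ltn_pmod (p m * k) b0)))//= eqxx big1 => [|r rk].
  by rewrite addr0 mul1r mulrC (prim_expr_mod lamP).
have /negbTE -> : ((p m * k) %% b != r)%N by rewrite eq_sym; exact: rk.
by rewrite rmorph0 mul0r mulr0.
Qed.

(** If the candidate eigenfunction vanished almost everywhere, so would the limits of the Fourier
    sums over the bases of the towers of level m. But for each n > m the sizes of these sums add up
    to at least delta / (2 p_m). *)
Lemma eigenvalue_of_residues (delta : R) m : 0 < delta ->
  (forall n, (0 < n)%N -> delta <= P [set x | tau n x = t n]) ->
  (forall e : R, 0 < e -> exists N, forall n, (N <= n)%N -> (p n)%:R^-1 <= e) ->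
  (forall n, (m < n)%N -> 2^-1 <= \sum_(t1 : vertex B m)
     normc (\sum_(k \in suffix_set t1 (t n)) lam ^- (p m * k)) / (qprod q m n)%:R) ->
  eigenvalue_for T mu lam.
Proof.
move=> d0 dt p_infty hm; have mY := measurable_residue_set.
have [U [UP oU Ulim]] := nat_ultralimit R.
(* The value 0 on non measurable sets keeps the sequences in [0, 1], so that a limit exists for
   every A. *)
pose u r A n : R := if `[< measurable A >] then P (A `&` Y r n) else 0.
have uE r A n : measurable A -> u r A n = P (A `&` Y r n) by move=> mA; rewrite /u asboolT.
have u01 r A n : 0 <= u r A n <= 1.
  rewrite /u; case: asboolP => mA; last by rewrite lexx ler01.
  by rewrite pr_ge0/= pr_le1//; exact: measurableI.
pose nu r A : R := projT1 (cid (Ulim _ (u01 r A))).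
have nuP r A : u r A @ U --> nu r A by rewrite /nu; case: cid.
have nu_ge0 r A : 0 <= nu r A.
  by apply: (cvgr_to_ge (nuP r A)); near=> n; case/andP: (u01 r A n).
have nu_add r A C : measurable A -> measurable C -> A `&` C = set0 ->
    nu r (A `|` C) = nu r A + nu r C.
  move=> mA mC AC; apply: (cvg_unique _ (nuP r (A `|` C))) => //.
  rewrite (_ : u r (A `|` C) = u r A + u r C); first exact: cvgD.
  apply/funext => n; rewrite fctE !uE//; last exact: measurableU.
  rewrite setIUl prU//; [exact: measurableI|exact: measurableI|].
  by rewrite setIACA AC set0I.
have nu_le r A : measurable A -> nu r A <= P A.
  move=> mA; apply: (cvgr_to_le (nuP r A)); near=> n; rewrite uE//.
  by apply: pr_le => //; exact: measurableI.
have nu_mod r A : nu (r %% b)%N A = nu r A.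
  apply: (cvg_unique _ (nuP (r %% b)%N A)) => //.
  rewrite (_ : u (r %% b)%N A = u r A); first exact: nuP.
  by apply/funext => n; rewrite /u residue_set_modb.
have nu_shift r A : measurable A -> nu r.+1 (T @^-1` A) = nu r A.
  move=> mA; have mTA : measurable (T @^-1` A : set (borel X)) by exact: measurable_vershik.
  apply/eqP; rewrite -subr_eq0; apply/eqP.
  have cd : (u r.+1 (T @^-1` A) - u r A) @ U --> nu r.+1 (T @^-1` A) - nu r A.
    by apply: cvgB; exact: nuP.
  apply: (cvg_unique _ cd) => //; apply/cvgr0Pnorm_le => e e0; apply: oU.
  have [N hN] := p_infty e e0; exists N => // n /= Nn.
  rewrite -[X in `|X|]/(u r.+1 (T @^-1` A) n - u r A n) !uE//.
  by apply: le_trans (hN n Nn); exact: residue_set_shift.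
have dens r := @dominated_density R B mu (nu r) (nu_ge0 r) (nu_add r) (nu_le r).
have [h0 h0P] := choice dens.
(* Indexing by residues makes [h] periodic in r by construction. *)
pose h r := h0 (r %% b)%N.
have hP r : [/\ forall x, 0 <= h r x,
      mu.-integrable [set: borel X] (fun x : borel X => (h r x)%:E) &
      forall A, measurable A -> (\int[mu]_(x in A) (h r x)%:E = (nu r A)%:E)%E].
  by have [? ? H] := h0P (r %% b)%N; split=> // A mA; rewrite H// nu_mod.
have mh r : measurable_fun [set: borel X] (h r : borel X -> R).
  by have [_ /measurable_int/measurable_EFinP ? _] := hP r.
have mT : measurable_fun [set: borel X] (T : borel X -> borel X).
  by move=> _ A mA; rewrite setTI; exact: measurable_vershik.
apply: (@eigenvalue_of_densities R X T mu b lam lamP h) => //.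
- move=> r; have [hr0 hri hrE] := hP r; have [hr10 hr1i hr1E] := hP r.+1.
  have : ae_eq mu setT (fun x : borel X => (h r.+1 x)%:E)
      (fun x : borel X => (h r (T x))%:E).
    apply: integral_ae_eq => //.
      by apply/measurable_EFinP; exact: (measurableT_comp (mh r) mT).
    (* Since E = T^(-1)(A), [nu_shift] and a change of variables show that both functions have the
       same integral over E. *)
    move=> E _ mE; pose A : set (borel X) := S @^-1` E.
    have mA : measurable A by exact: continuous_borel.
    have -> : E = T @^-1` A by apply/seteqP; split => x; rewrite /A /= TK.
    rewrite hr1E ?nu_shift//; last exact: measurable_vershik.
    have := @ge0_integral_pushforward _ _ (borel X) (borel X) R T mT mu A
      (fun x => (h r x)%:E) mA _ _.
    rewrite /comp /= => <-.
    + rewrite -hrE//; apply: eq_measure_integral => C mC _.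
      exact/esym/muT.
    + apply/measurable_EFinP; exact: measurable_funTS.
    + by move=> x _; rewrite lee_fin.
  by apply: filterS => x /= H; have [] := H Logic.I.
- by move=> x; rewrite /h modnn mod0n.
move=> g0.
(* Integration turns a linear relation between the densities into one between the set functions; it
   is used for the real and imaginary parts separately. *)
have int0 (w : nat -> R) : {ae mu, forall x : borel X, \sum_(r < b) w r * h r x = 0} ->
    forall A, measurable A -> \sum_(r < b) w r * nu r A = 0.
  move=> w0 A mA.
  have i0 : (\int[mu]_(x in A) (\sum_(r < b) (w r)%:E * (h r x)%:E) = 0)%E.
    transitivity (\int[mu]_(x in A) (cst 0%E x))%E; last by rewrite integral0.
    apply: ae_eq_integral => //.
      apply: emeasurable_sum => r; apply: emeasurable_funM => //.
      by apply/measurable_EFinP; exact: measurable_funTS.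
    apply: filterS w0 => x wx _ /=; under eq_bigr do rewrite -EFinM.
    by rewrite sumEFin wx.
  have hi (r : 'I_b) : mu.-integrable A (fun x => (h r x)%:E).
    by have [_ hi _] := hP r; apply: integrableS hi.
  move: i0; rewrite integral_sum//; last by move=> r; exact: integrableZl.
  under eq_bigr => r _.
    rewrite integralZl//; have [_ _ ->//] := hP r; rewrite -EFinM.
    over.
  by rewrite sumEFin => -[].
have re0 : forall A, measurable A -> \sum_(r < b) complex.Re (lam ^- r) * nu r A = 0.
  apply: (int0 (fun r => complex.Re (lam ^- r))).
  apply: filterS g0 => x /(congr1 (@complex.Re R)).
  rewrite Re_sum => E; apply: etrans (E : _ = (0 : R)).
  by apply: eq_bigr => r _; rewrite Re_realM.
have im0 : forall A, measurable A -> \sum_(r < b) complex.Im (lam ^- r) * nu r A = 0.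
  apply: (int0 (fun r => complex.Im (lam ^- r))).
  apply: filterS g0 => x /(congr1 (@complex.Im R)).
  rewrite Im_sum => E; apply: etrans (E : _ = (0 : R)).
  by apply: eq_bigr => r _; rewrite Im_realM.
have mat (t1 : vertex B m) : measurable (atom t1 0) by exact: measurable_atom.
pose V (t1 : vertex B m) n : R := \sum_(r < b) complex.Re (lam ^- r) * u r (atom t1 0) n.
pose W (t1 : vertex B m) n : R := \sum_(r < b) complex.Im (lam ^- r) * u r (atom t1 0) n.
have V0 t1 : V t1 @ U --> (0 : R).
  rewrite -(re0 _ (mat t1)); apply: cvg_sum_seq => r.
  by apply: cvgMl_tmp; exact: nuP.
have W0 t1 : W t1 @ U --> (0 : R).
  rewrite -(im0 _ (mat t1)); apply: cvg_sum_seq => r.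
  by apply: cvgMl_tmp; exact: nuP.
have VW0 : (fun n => \sum_(t1 : vertex B m) (`|V t1 n| + `|W t1 n|)) @ U --> (0 : R).
  have := @cvg_sum_seq R _ (index_enum (vertex B m)) U _
    (fun t1 n => `|V t1 n| + `|W t1 n|) (fun=> `|0 : R| + `|0 : R|).
  rewrite normr0 addr0 big1//; apply=> t1.
  by rewrite -[0]addr0 -{1 2}(normr0 R); apply: cvgD; apply: cvg_norm.
have pm0 : 0 < (p m)%:R :> R by rewrite ltr0n qprod_gt0.
have c0 : 0 < delta / (2 * (p m)%:R) by rewrite divr_gt0// mulr_gt0.
suff : delta / (2 * (p m)%:R) <= 0 by rewrite leNgt c0.
(* The limit inherits a bound that is uniform in n: the sum is at least c / p_n times q_{m,n} / 2,
   with c >= delta and p_n = p_m q_{m,n}. *)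
apply: (cvgr_to_ge VW0); apply: oU; exists m.+1 => // n /= mn.
have n0 : (0 < n)%N by exact: leq_ltn_trans mn.
have dn := dt n n0.
have qn0 : 0 < (qprod q m n)%:R :> R by rewrite ltr0n qprod_gt0.
have pE : (p n)%:R = (p m)%:R * (qprod q m n)%:R :> R.
  by rewrite -natrM qprodM// ltnW.
have ex k : (k < qprod q m n)%N -> exists x, tau n x = t n /\ suffix_count m n x = k.
  move=> kq; have Pk := suffix_pr tB pB muT (t n) (ltnW mn) kq.
  apply: contrapT => nx; move: Pk; rewrite (_ : _ `&` _ = set0) ?pr0 ?mul0r.
    by move=> E; move: dn; rewrite -E leNgt d0.
  by apply/seteqP; split => // x [tx sx]; apply: nx; exists x.
have key t1 : P [set x | tau n x = t n] / (p n)%:R *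
    normc (\sum_(k \in suffix_set t1 (t n)) lam ^- (p m * k)) <= `|V t1 n| + `|W t1 n|.
  have := residue_fourier t1 mn ex.
  set c := P _ / _; set Z := \sum_(k \in _) _ => E.
  have cge0 : 0 <= c by rewrite divr_ge0 ?pr_ge0.
  have -> : c * normc Z = normc ((c%:C)%C * Z).
    by rewrite normcM; congr (_ * _); rewrite /normc/= expr0n/= addr0 sqrtr_sqr ger0_norm.
  rewrite -E; have -> : V t1 n = complex.Re (\sum_(r < b) lam ^- r * ((P (atom t1 0 `&` Y r n))%:C)%C).
    by rewrite Re_sum; apply: eq_bigr => r _; rewrite Re_realM uE.
  have -> : W t1 n = complex.Im (\sum_(r < b) lam ^- r * ((P (atom t1 0 `&` Y r n))%:C)%C).
    by rewrite Im_sum; apply: eq_bigr => r _; rewrite Im_realM uE.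
  case: (\sum_(r < b) _) => v w /=.
  rewrite -[leRHS]ger0_norm ?addr_ge0// -sqrtr_sqr ler_wsqrtr// sqrrD.
  have := mulr_ge0 (normr_ge0 v) (normr_ge0 w).
  by rewrite !real_normK ?num_real// => ?; lra.
apply: le_trans (ler_sum _ (fun t1 _ => key t1)).
rewrite -mulr_sumr pE.
have := hm n mn; rewrite -mulr_suml => h2.
move: dn h2 qn0; set c := P _; set sg := \big[_/_]_(_ <- _ | _) _; set Q := (qprod _ _ _)%:R => dn h2 qn0.
have -> : c / ((p m)%:R * Q) * sg = (c / (p m)%:R) * (sg / Q).
  by field; rewrite !gt_eqF.
have -> : delta / (2 * (p m)%:R) = (delta / (p m)%:R) * 2^-1 by field; rewrite gt_eqF.
apply: ler_pM => //; first by rewrite divr_ge0// ltW.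
by rewrite ler_wpM2r// invr_ge0 ltW.
Unshelve. all: by end_near.
Qed.

End EigenvalueSufficient.

(** * Arithmetic of the heights and conclusion *)

Lemma gcdn_qprod_stable (q : nat -> nat) b : (0 < b)%N ->
  exists N, forall n, (N <= n)%N -> gcdn b (qprod q 0 n) = gcdn b (qprod q 0 N).
Proof.
move=> b0; pose g n := gcdn b (qprod q 0 n).
have gle n : (g n <= b)%N by apply: dvdn_leq => //; exact: dvdn_gcdl.
have gdvd m n : (m <= n)%N -> (g m %| g n)%N.
  move=> mn; rewrite dvdn_gcd dvdn_gcdl/= -(qprodM q (leq0n m) mn).
  by apply: dvdn_mulr; exact: dvdn_gcdr.
have ex : exists k, `[< exists n, g n = k >] by exists (g 0%N); apply/asboolP; exists 0%N.
have ub k : `[< exists n, g n = k >] -> (k <= b)%N by move=> /asboolP[n <-].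
(* The gcds increase for divisibility and are at most b, so they are constant from an index where
   the largest is reached. *)
have [k /asboolP[N gN] mx] := ex_maxnP ex ub.
exists N => n Nn; apply/eqP; rewrite eqn_leq -/(g n) -/(g N); apply/andP; split.
  by rewrite gN; apply: mx; apply/asboolP; exists n.
by apply: dvdn_leq (gdvd _ _ Nn); rewrite gcdn_gt0 b0.
Qed.

Section RankBounds.
Context (B : bratteli) (q : nat -> nat) (tB : toeplitz_type B q) (d : nat)
  (vtx : forall n, 'I_d -> vertex B n).

Lemma card_vertex n : bijective (vtx n) -> #|vertex B n| = d.
Proof. by move=> /bij_eq_card; rewrite card_ord. Qed.

Lemma card_vertex_le_q n :
  (forall t1 t2, (0 < @adjacency B n t1 t2)%N) -> (#|vertex B n| <= q n.+1)%N.
Proof.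
move=> adj; have [e _] := edge_family_exists B.
rewrite -(tB (tgt (e n))); apply: leq_trans (leq_imset_card src _).
rewrite -cardsT; apply: subset_leq_card; apply/fintype.subsetP => t _.
have /card_gt0P[f] := adj t (tgt (e n)); rewrite inE => /andP[/eqP <- tf].
by apply: imset_f; rewrite inE.
Qed.

Lemma qprod_unbounded (R : realType) : (forall n, 2 <= q n.+2)%N ->
  forall e : R, 0 < e -> exists N, forall n, (N <= n)%N -> (qprod q 0 n)%:R^-1 <= e.
Proof.
move=> q2 e e0; have q_pos := q_gt0 tB.
have p2 n : (2 ^ n <= qprod q 0 n.+1)%N.
  elim: n => [|n IH]; first exact: qprod_gt0.
  by rewrite qprodSr// expnSr leq_mul.
exists (Num.trunc e^-1).+2 => -[//|n]; rewrite ltnS => Nn.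
rewrite -[leRHS]invrK lef_pV2 ?posrE ?invr_gt0 ?ltr0n ?qprod_gt0//.
apply: (@le_trans _ _ (Num.trunc e^-1).+1%:R); first by apply/ltW/truncnS_gt.
rewrite ler_nat; apply: leq_trans (p2 n); apply: leq_trans Nn _.
exact/ltnW/ltn_expl.
Qed.

End RankBounds.

(** Were the set empty, the measures of the d vertex sets of level n would all tend to 0, although
    they add up to 1 for each n >= 1. *)
Lemma clean_nonempty (R : realType) (B : bratteli) (d : nat)
    (vtx : forall n, 'I_d -> vertex B n)
    (mu : probability (borel (path_space B)) R) (J : {set 'I_d}) :
  (forall n, (0 < n)%N -> bijective (vtx n)) ->
  (forall t, t \notin J ->
     mu [set x | tau n x = vtx n t] @[n --> \oo] --> 0%E) ->
  exists t, t \in J.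
Proof.
move=> bij J0; apply: contrapT => nJ.
have lim0 t : (fun n => fine (mu [set x | tau n x = vtx n t])) @ \oo --> (0 : R).
  have /J0 : t \notin J by apply/negP => tJ; apply: nJ; exists t.
  by move=> /fine_cvgP[].
have := @cvg_sum_seq R _ (index_enum 'I_d) \oo eventually_filter
  (fun t n => fine (mu [set x | tau n x = vtx n t])) (fun=> 0) lim0.
rewrite big1// => sum0; suff : (1 : R) <= 0 by rewrite ler10.
apply: (cvgr_to_ge sum0); exists 1%N => // n /= n0.
have := @pr_partition R B mu _ (@tau B n) setT measurableT.
rewrite prT => -> ; last first.
  by move=> t; apply: (@determined_measurable B n.+1) => x y xy /=; rewrite /tau xy.
rewrite (reindex (vtx n)); last exact/onW_bij/bij.
by apply: ler_sum => t _; rewrite setTI.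
Qed.

Theorem theorem3 (R : realType) (B : bratteli) (d : nat)
    (vtx : forall n, 'I_d -> vertex B n) (q : nat -> nat)
    (I : probability (borel (path_space B)) R -> {set 'I_d})
    (B_minimal : minimal_cantor_system (vershik B))
    (B_proper : proper_of_rank vtx)
    (B_toeplitz : toeplitz_type B q)
    (B_clean : clean vtx I)
    (mu : probability (borel (path_space B)) R)
    (mu_ergodic : ergodic (vershik B) mu)
    (a : int) (b : nat) (b_ge1 : (1 <= b)%N) (coprime_ab : coprimez a b%:Z) :
  let lambda : R[i] := expi (2 * pi * (a%:~R / b%:R)) in
  let p n := qprod q 0 n in
  noncontinuous_eigenvalue_for (vershik B) mu lambda <->
  (exists bb : nat, (1 < bb <= d)%N /\
     (\forall n \near \oo, (b %/ gcdn b (p n))%N = bb)) /\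
  (forall t2, t2 \in I mu ->
     forall eps : R, 0 < eps ->
     exists N : nat, forall m n : nat, (N < m)%N -> (m < n)%N ->
       `| \sum_(t1 : vertex B m)
            normc (\sum_(s \in suffix_set t1 (vtx n t2)) lambda ^- (p m * s))
              / (qprod q m n)%:R
          - 1 | < eps).
Proof.
move=> lambda p.
have lamP : b.-primitive_root lambda := expi_primitive R b_ge1 coprime_ab.
have [_ cT [S cS [TK _]] minT] := B_minimal.
have [pB [_ adj bij H4]] := B_proper.
have [[delta d0 cl] _] := B_clean.
have [clI clnI] := cl mu mu_ergodic.
have muT : forall A : set (borel (path_space B)), measurable A ->
    mu (vershik B @^-1` A) = mu A := mu_ergodic.1.
have dI t2 : t2 \in I mu -> forall n, (0 < n)%N ->
    delta <= fine (mu [set x | tau n x = vtx n t2]).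
  move=> /clI dt n n0; rewrite -lee_fin -prE ?dt//.
  exact: measurable_tau.
split.
- move=> [eig ncont].
  have [A [mA [FT [Z [mZ Z0 FZ]]]]] := quantized_eigenfunction cT cS TK mu_ergodic lamP eig.
  split; last first.
    move=> t2 /dI dt2 eps e0.
    exact: (suffix_sums_concentrate B_toeplitz pB muT lamP mA FT mZ Z0 FZ d0 dt2 e0).
  have [N gN] := gcdn_qprod_stable q b_ge1.
  have [N' ordN'] := residual_order_le_card B_toeplitz pB cT muT lamP mA FT mZ Z0 FZ.
  exists (b %/ gcdn b (p N))%N; split; last first.
    by exists N => // n /= Nn; rewrite gN.
  apply/andP; split.
    rewrite ltn_neqAle divn_gt0 ?gcdn_gt0 ?b_ge1// dvdn_leq ?dvdn_gcdl// andbT.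
    (* If the quotient were 1, b would divide p_N and the eigenvalue would be continuous. *)
    apply/eqP => g1; apply: ncont; apply: (dvd_continuous_eigenvalue B_toeplitz pB lamP (n := N)).
    apply/gcdn_idPl; rewrite -[LHS]mul1n g1.
    by rewrite divnK// dvdn_gcdl.
  (* The successor makes M positive, as needed for [vtx M] to be bijective. *)
  pose M := (maxn N N').+1.
  have <- : #|vertex B M| = d by apply: card_vertex; exact: bij.
  rewrite -(gN M); last by apply: leqW; exact: leq_maxl.
  by apply: ordN'; apply: leqW; exact: leq_maxr.
- move=> [[bb [/andP[bb1 bbd] [N1 _ bbN]]] sums]; split; last first.
    (* A continuous eigenvalue would make b divide p_n for large n, so the quotient would be 1. *)
    move=> /(continuous_eigenvalue_dvd B_toeplitz pB lamP H4 minT)[N2 dvd].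
    have := bbN (maxn N1 N2) (leq_maxl _ _).
    have /gcdn_idPl -> := dvd (maxn N1 N2) (leq_maxr _ _).
    by rewrite divnn b_ge1 => bbE; rewrite -bbE in bb1.
  have [t2 t2I] := clean_nonempty bij clnI.
  (* Being within 1/2 of 1 gives the lower bound 1/2 required at the fixed level N + 1. *)
  have [N hN] := sums t2 t2I 2^-1 (ltac:(lra)).
  (* From level 2 on every vertex receives an edge from each of the d vertices below, and d >= 2
     because 1 < bb <= d. *)
  have q2 n : (2 <= q n.+2)%N.
    apply: leq_trans (card_vertex_le_q B_toeplitz (adj n)).
    have -> : #|vertex B n.+1| = d by apply: card_vertex; exact: bij.
    exact: leq_trans bb1 bbd.
  apply: (@eigenvalue_of_residues R B q B_toeplitz pB cT S cS TK mu muT b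
    lambda lamP (fun n => vtx n t2) delta N.+1 d0 (dI t2 t2I)).
    exact: (qprod_unbounded B_toeplitz q2).
  move=> n Nn; have := hN N.+1 n (ltnSn N) Nn.
  by rewrite ltr_norml => /andP[h _]; move: h; lra.
Qed.
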